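(* Let $(W,S)$ be an irreducible finite Coxeter group of rank $n$ and Coxeter number $h$. Let $X_{\mathrm{des}+\mathrm{ides}}$ be the value of $\mathrm{des}(w)+\mathrm{des}(w^{-1})$ and $X_{\mathrm{des}}$ the value of $\mathrm{des}(w)$ for $w\in W$ chosen uniformly at random. Then \[ \mathbb{E}(X_{\mathrm{des}+\mathrm{ides}})=n,\qquad \mathbb{V}(X_{\mathrm{des}+\mathrm{ides}}) = 2\,\mathbb{V}(X_{\mathrm{des}})+\frac nh. \]
   Context: Fix a root system for $(W,S)$ with simple roots $\Delta$ and negative roots $\Phi^-$; $\mathrm{des}(w)=\#\{\beta\in\Delta : w(\beta)\in\Phi^-\}$. The Coxeter number $h$ is the order of a product of all simple reflections of $W$ (in any order). *)

(* Defs.v *)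
From HB Require Import structures.
From mathcomp Require Import all_boot all_order all_algebra.
From mathcomp Require Import reals trigo.
Set Implicit Arguments. Unset Strict Implicit. Unset Printing Implicit Defensive.
Import Order.TTheory GRing.Theory Num.Theory.
Local Open Scope ring_scope.

(* A Coxeter matrix of rank n with finite entries (finite Coxeter groups
   have all m_ij finite). *)
Definition coxeter_matrix (n : nat) (M : 'M[nat]_n) : Prop :=
  (forall i, M i i = 1%N) /\ (forall i j, M i j = M j i) /\
  (forall i j, i != j -> (2 <= M i j)%N).

Definition coxeter_irreducible (n : nat) (M : 'M[nat]_n) : Prop :=
  forall i j : 'I_n, connect (fun a b => (2 < M a b)%N) i j.

Section Geometric.
Variables (R : realType) (n : nat) (M : 'M[nat]_n).

(* Bilinear form on V = R^n with basis the simple roots alpha_i: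
   B(alpha_i, alpha_j) = - cos (pi / m_ij). *)
Definition cox_form (i j : 'I_n) : R := - cos (pi / (M i j)%:R).

(* Simple reflection s_i(v) = v - 2 B(alpha_i, v) alpha_i, as a matrix acting
   on coordinate column vectors w.r.t. the simple roots. *)
Definition simple_refl (i : 'I_n) : 'M[R]_n :=
  \matrix_(k, l) ((k == l)%:R - 2 * (k == i)%:R * cox_form i l).

Definition word_mx (s : seq 'I_n) : 'M[R]_n :=
  foldr (fun i A => simple_refl i *m A) 1%:M s.

Definition in_W (w : 'M[R]_n) : Prop := exists s : seq 'I_n, w = word_mx s.

Definition coxeter_element : 'M[R]_n := word_mx (enum 'I_n).

Definition mxpow (A : 'M[R]_n) (k : nat) : 'M[R]_n := iter k (mulmx A) 1%:M.

Definition is_coxeter_number (h : nat) : Prop :=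
  (0 < h)%N /\ mxpow coxeter_element h = 1%:M /\
  (forall k, (0 < k < h)%N -> mxpow coxeter_element k != 1%:M).

(* w(alpha_i) is the i-th column of w; it is a negative root iff all its
   coordinates are <= 0.  des(w) = #{i | w(alpha_i) in Phi^-}. *)
Definition des (w : 'M[R]_n) : nat :=
  #|[set i : 'I_n | [forall k : 'I_n, w k i <= 0]]|.

End Geometric.

Definition mean (R : realType) (T : Type) (L : seq T) (X : T -> R) : R :=
  (\sum_(w <- L) X w) / (size L)%:R.

Definition variance (R : realType) (T : Type) (L : seq T) (X : T -> R) : R :=
  mean L (fun w => (X w - mean L X) ^+ 2).

(* Main.v *)
Require Import Defs.
From HB Require Import structures.
From mathcomp Require Import all_boot all_order all_algebra.
From mathcomp Require Import classical_sets functions boolp.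
From mathcomp Require Import reals topology normedtype derive trigo.
From mathcomp Require Import zify ring lra.
Import Order.TTheory GRing.Theory Num.Theory.
Import numFieldNormedType.Exports.
Set Implicit Arguments.
Unset Strict Implicit.
Unset Printing Implicit Defensive.
Local Open Scope ring_scope.

(** With [e_i(w)] the sign of the root [w a_i], the covariance of [des w] and
    [des w^-1] is a quarter of the average of [\sum_(i, j) e_i(w) e_j(w^-1)].
    The involution [w -> s_j w] flips [e_j(w^-1)], and it flips [e_i(w)] only if
    [w a_i] is [a_j] or [- a_j]; so this average is twice the expected number of
    pairs [(i, j)] with [w a_i = a_j], and it remains to see that a random
    [w a_i] is simple with probability [1 / h].

    Let [c] be a Coxeter element.  The positive roots sent to negative ones by
    [c] are [w_j a_j] for suitable [w_j], one for each [j], so the probability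
    that [w a_i] is simple is the probability that [w a_i > 0 > c w a_i].
    Averaging over the powers of [c], it is enough that along each orbit
    [b, c b, ..., c^h b = b] of a root, the sign drops exactly once.  As finite
    Coxeter graphs are forests, all Coxeter elements are conjugate, and [c] can
    be taken bipartite.  A Perron-Frobenius vector then yields a plane on which
    [c] acts as the rotation by [2 pi / h] and which meets the open fundamental
    chamber: the signs of the [c^k b] are those of a sinusoid sampled at [h]
    equidistant points of one period. *)

(** * The geometric representation *)

(** With [x = pi / m] one has [3 x <= pi], so [sin (3 x) = sin x (4 cos^2 x - 1)] is nonnegative
    while [sin x > 0]. This bounds the form on every edge of the Coxeter graph by [- 1 / 2]. *)
Lemma cos_ge_half (R : realType) m : (2 < m)%N -> 1 / 2 <= cos (pi / m%:R) :> R.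
Proof.
move=> m3; have m0 : (0 < m%:R :> R) by rewrite ltr0n; lia.
have m3R : 3 <= m%:R :> R by rewrite ler_nat.
have x0 : 0 < (pi / m%:R : R) by rewrite divr_gt0 ?pi_gt0.
have x3 : 3 * (pi / m%:R) <= pi :> R.
  by rewrite mulrCA ler_piMr ?pi_ge0 // ler_pdivrMr // mul1r.
move: (pi / m%:R) x0 x3 => x x0 x3; have p0 := pi_gt0 R.
have s0 : 0 < sin x by apply: sin_gt0_pi; rewrite x0; lra.
have c0 : 0 <= cos x by apply: cos_ge0_pihalf; apply/andP; split; lra.
have : 0 <= sin (3 * x) by apply: sin_ge0_pi; rewrite x3 andbT; lra.
have -> : 3 * x = x + x + x by ring.
rewrite !(sinD, cosD); have := cos2Dsin2 x; move: (sin x) (cos x) s0 c0 => s c s0 c0 e.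
have -> : (s * c + c * s) * c + (c * c - s * s) * s = s * (4 * c ^+ 2 - (c ^+ 2 + s ^+ 2)) by ring.
rewrite e pmulr_rge0 // => c2; rewrite leNgt; apply/negP => c1.
by nra.
Qed.

Section Form.
Variables (R : realType) (n : nat) (M : 'M[nat]_n).
Hypothesis coxM : coxeter_matrix M.

Definition sroot (i : 'I_n) : 'cV[R]_n := delta_mx i 0.

Definition gram : 'M[R]_n := \matrix_(i, j) cox_form R M i j.

Definition cform (u v : 'cV[R]_n) : R := (u^T *m gram *m v) 0 0.

Lemma cox_formC i j : cox_form R M i j = cox_form R M j i.
Proof. by rewrite /cox_form coxM.2.1. Qed.

Lemma cox_form_diag i : cox_form R M i i = 1.
Proof. by rewrite /cox_form coxM.1 divr1 cospi opprK. Qed.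

Lemma cox_angle i j : i != j -> 0 < (pi / (M i j)%:R : R) <= pi / 2.
Proof.
move=> ij; have m2 : (2 <= M i j)%N by exact: coxM.2.2.
have m0 : (0 < (M i j)%:R :> R) by rewrite ltr0n; apply: leq_trans m2.
rewrite divr_gt0 ?pi_gt0 //= ler_pM2l ?pi_gt0 // lef_pV2 ?posrE //.
by rewrite ler_nat.
Qed.

Lemma cox_form_le0 i j : i != j -> cox_form R M i j <= 0.
Proof.
move=> /cox_angle/andP[a0 a1]; rewrite /cox_form oppr_le0 cos_ge0_pihalf //.
by rewrite a1 andbT; apply: le_trans (ltW a0); have := pi_gt0 R; lra.
Qed.

Lemma cox_form_le i j : (2 < M i j)%N -> cox_form R M i j <= - (1 / 2).
Proof. by move=> /(cos_ge_half R); rewrite /cox_form lerN2. Qed.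

Lemma cformDr u v w : cform u (v + w) = cform u v + cform u w.
Proof. by rewrite /cform mulmxDr mxE. Qed.

Lemma cformZr u a v : cform u (a *: v) = a * cform u v.
Proof. by rewrite /cform -scalemxAr mxE. Qed.

Lemma cformDl u v w : cform (u + v) w = cform u w + cform v w.
Proof. by rewrite /cform linearD /= !mulmxDl mxE. Qed.

Lemma cformZl a u v : cform (a *: u) v = a * cform u v.
Proof. by rewrite /cform linearZ /= -!scalemxAl mxE. Qed.

Lemma cformNl u v : cform (- u) v = - cform u v.
Proof. by rewrite -scaleN1r cformZl mulN1r. Qed.

Lemma cformNr u v : cform u (- v) = - cform u v.
Proof. by rewrite -scaleN1r cformZr mulN1r. Qed.

Lemma cform0r u : cform u 0 = 0.
Proof. by rewrite /cform mulmx0 mxE. Qed.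

Lemma cform_sumr I (r : seq I) (P : pred I) u (F : I -> 'cV_n) :
  cform u (\sum_(i <- r | P i) F i) = \sum_(i <- r | P i) cform u (F i).
Proof.
apply: (big_morph (cform u)) => [v w|]; [exact: cformDr | exact: cform0r].
Qed.

Lemma cformC u v : cform u v = cform v u.
Proof.
have -> : cform v u = ((v^T *m gram *m u)^T) 0 0 by rewrite mxE.
rewrite !trmx_mul trmxK mulmxA; suff -> : gram^T = gram by [].
by apply/matrixP => i j; rewrite !mxE cox_formC.
Qed.

Lemma cform_sumE u v : cform u v = \sum_k u k 0 * cform (sroot k) v.
Proof.
rewrite {1}/cform -mulmxA mxE; apply: eq_bigr => k _.
by rewrite /cform -mulmxA trmx_delta -rowE [in RHS]mxE [u^T _ _]mxE.
Qed.

Lemma cform_srootl i v : cform (sroot i) v = \sum_k cox_form R M i k * v k 0.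
Proof.
rewrite /cform -mulmxA trmx_delta -rowE !mxE.
by apply: eq_bigr => k _; rewrite mxE.
Qed.

Lemma cform_sroot i j : cform (sroot i) (sroot j) = cox_form R M i j.
Proof.
rewrite cform_srootl (bigD1 j) //= mxE !eqxx mulr1 big1 ?addr0 // => k kj.
by rewrite mxE (negPf kj) mulr0.
Qed.

Lemma refl_mulE i v :
  simple_refl R M i *m v = v - (2 * cform (sroot i) v) *: sroot i.
Proof.
apply/colP => k; rewrite !mxE cform_srootl.
rewrite (eq_bigr (fun l => (k == l)%:R * v l 0 -
   2 * (k == i)%:R * (cox_form R M i l * v l 0))); last first.
  by move=> l _; rewrite mxE; ring.
rewrite sumrB -mulr_sumr; congr (_ - _); last by rewrite eqxx andbT; ring.
rewrite (bigD1 k) //= eqxx mul1r big1 ?addr0 // => l; rewrite eq_sym => /negPf->.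
by rewrite mul0r.
Qed.

Lemma refl_sroot i : simple_refl R M i *m sroot i = - sroot i.
Proof.
rewrite refl_mulE cform_sroot cox_form_diag mulr1 scaler_nat mulr2n opprD.
by rewrite addrA subrr sub0r.
Qed.

Lemma cform_refl i u v :
  cform (simple_refl R M i *m u) (simple_refl R M i *m v) = cform u v.
Proof.
rewrite !refl_mulE !(cformDl, cformDr, cformNl, cformNr, cformZl, cformZr).
by rewrite cform_sroot cox_form_diag (cformC u (sroot i)); ring.
Qed.

Lemma mx_ext (A B : 'M[R]_n) : (forall v : 'cV_n, A *m v = B *m v) -> A = B.
Proof.
move=> AB; apply/matrixP => i j.
by have := congr1 (fun X : 'cV_n => X i 0) (AB (sroot j)); rewrite -!colE !mxE.
Qed.

Lemma reflK i : simple_refl R M i *m simple_refl R M i = 1%:M.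
Proof.
apply: mx_ext => v; rewrite mul1mx -mulmxA !refl_mulE.
rewrite cformDr cformNr cformZr cform_sroot cox_form_diag.
by rewrite -addrA -opprD -scalerDl [X in X *: _](_ : _ = 0) ?scale0r ?subr0 //; ring.
Qed.

Lemma word_cat s t : word_mx R M (s ++ t) = word_mx R M s *m word_mx R M t.
Proof. by elim: s => [|i s IH] /=; rewrite ?mul1mx // IH mulmxA. Qed.

Lemma word1 i : word_mx R M [:: i] = simple_refl R M i.
Proof. by rewrite /= mulmx1. Qed.

Lemma word_rcons s i : word_mx R M (rcons s i) = word_mx R M s *m simple_refl R M i.
Proof. by rewrite -cats1 word_cat word1. Qed.

Lemma word_rev s : word_mx R M (rev s) *m word_mx R M s = 1%:M.
Proof.
elim: s => [|i s IH]; first by rewrite mulmx1.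
by rewrite rev_cons word_rcons /= -mulmxA (mulmxA (simple_refl _ _ _)) reflK mul1mx.
Qed.

Lemma word_revr s : word_mx R M s *m word_mx R M (rev s) = 1%:M.
Proof. by rewrite -{1}(revK s) word_rev. Qed.

Lemma word_unit s : word_mx R M s \in unitmx.
Proof. by have /mulmx1_unit[] := word_revr s. Qed.

Lemma word_inv s : invmx (word_mx R M s) = word_mx R M (rev s).
Proof.
by rewrite -[RHS]mul1mx -(mulVmx (word_unit s)) -mulmxA word_revr mulmx1.
Qed.

Lemma cform_word s u v : cform (word_mx R M s *m u) (word_mx R M s *m v) = cform u v.
Proof.
elim: s => [|i s IH] /=; first by rewrite !mul1mx.
by rewrite -!mulmxA cform_refl.
Qed.

(** Since the form is invariant, conjugating the reflection in a root by [w] gives the reflection in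
    the image of that root under [w]. *)
Lemma word_refl_conj s i j : word_mx R M s *m sroot i = sroot j ->
  word_mx R M s *m simple_refl R M i = simple_refl R M j *m word_mx R M s.
Proof.
move=> sij; apply: mx_ext => v; rewrite -!mulmxA !refl_mulE mulmxBr -scalemxAr sij.
by rewrite -sij cform_word.
Qed.

End Form.

(** * Positivity of roots *)

Section Positivity.
Variables (R : realType) (n : nat) (M : 'M[nat]_n).
Hypothesis coxM : coxeter_matrix M.
Local Notation word := (word_mx R M).
Local Notation sroot := (@sroot R n).

Lemma wlen_subproof s :
  exists k, [exists t : k.-tuple 'I_n, word t == word s].
Proof. by exists (size s); apply/existsP; exists (in_tuple s). Qed.

(** The Coxeter length of the group element [word s]; taking a word as argument makes the minimum
    exist at once. *)
Definition wlen s := ex_minn (wlen_subproof s).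

Lemma wlen_word s : exists2 t, size t = wlen s & word t = word s.
Proof.
rewrite /wlen; case: ex_minnP => k /existsP[t /eqP ts] _.
by exists t; rewrite ?size_tuple.
Qed.

Lemma wlen_le s t : word t = word s -> (wlen s <= size t)%N.
Proof.
move=> ts; rewrite /wlen; case: ex_minnP => k _; apply.
by apply/existsP; exists (in_tuple t); apply/eqP.
Qed.

Lemma wlen_cat s t : (wlen (s ++ t) <= wlen s + size t)%N.
Proof.
have [s' <- ss'] := wlen_word s; rewrite -size_cat; apply: wlen_le.
by rewrite !word_cat ss'.
Qed.

Lemma wlen_eq s t : word s = word t -> wlen s = wlen t.
Proof.
by move=> st; apply/eqP; rewrite eqn_leq; apply/andP; split;
  [have [r <- rE] := wlen_word t | have [r <- rE] := wlen_word s];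
  apply: wlen_le; rewrite rE.
Qed.

(** * Alternating words in rank two subgroups *)

Definition alt_letter (x y : 'I_n) (j : nat) := if odd j then y else x.

Definition alt_word x y j := mkseq (alt_letter x y) j.

Lemma alt_letterSS x y j : alt_letter x y j.+2 = alt_letter x y j.
Proof. by rewrite /alt_letter /= negbK. Qed.

Lemma alt_wordS x y j : alt_word x y j.+1 = rcons (alt_word x y j) (alt_letter x y j).
Proof. exact: mkseqS. Qed.

Lemma word_rev_alt_wordS x y j : word (rev (alt_word x y j.+1)) =
  simple_refl R M (alt_letter x y j) *m word (rev (alt_word x y j)).
Proof. by rewrite alt_wordS rev_rcons. Qed.

Lemma sin_cox_angle i t : i != t -> 0 < sin (pi / (M i t)%:R : R).
Proof.
move=> /(cox_angle R coxM)/andP[a0 a1]; apply: sin_gt0_pi; rewrite a0 /=.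
by apply: le_lt_trans a1 _; have := pi_gt0 R; lra.
Qed.

(** The plane spanned by [a_i] and [a_t] is stable, and each further reflection advances the
    coefficients by the recursion [sin ((j + 2) phi) = 2 cos phi sin ((j + 1) phi) - sin (j phi)].
    The letter that acts first is [t]. *)
Lemma alt_word_root i t j : i != t -> let phi := pi / (M i t)%:R in
  word (rev (alt_word t i j)) *m sroot i =
  (sin (j.+1%:R * phi) / sin phi) *: sroot (alt_letter t i j.+1) +
  (sin (j%:R * phi) / sin phi) *: sroot (alt_letter t i j).
Proof.
move=> it phi; have sphi : sin phi != 0 by rewrite gt_eqF // sin_cox_angle.
elim: j => [|j IH].
  by rewrite mul1mx mul1r divff // mul0r sin0 mul0r scale0r addr0 scale1r.
rewrite word_rev_alt_wordS -mulmxA IH mulmxDr -!scalemxAr refl_sroot // refl_mulE.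
have -> : cform M (sroot (alt_letter t i j)) (sroot (alt_letter t i j.+1)) = - cos phi.
  rewrite cform_sroot /cox_form /alt_letter /=.
  by case: (odd j); rewrite //= coxM.2.1.
rewrite alt_letterSS.
have -> : j.+2%:R * phi = j.+1%:R * phi + phi by rewrite -[j.+2]addn1 natrD; ring.
have -> : j%:R * phi = j.+1%:R * phi - phi by rewrite -[j.+1]addn1 natrD; ring.
move: (sroot _) (sroot _) => X Y; apply/colP => k; rewrite !mxE !sinD sinN cosN.
by field.
Qed.

Definition nonneg (v : 'cV[R]_n) := forall k, 0 <= v k 0.

Lemma nonneg_comb a b (u v : 'cV_n) : 0 <= a -> 0 <= b ->
  nonneg u -> nonneg v -> nonneg (a *: u + b *: v).
Proof. by move=> a0 b0 u0 v0 k; rewrite !mxE addr_ge0 // mulr_ge0. Qed.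

Lemma last_true (P : pred nat) a b :
  P a -> ~~ P b -> (a <= b)%N -> exists2 j, (a <= j < b)%N & P j && ~~ P j.+1.
Proof.
move=> Pa; elim: b => [|b IH] nPb.
  by rewrite leqn0 => /eqP a0; rewrite a0 (negPf nPb) in Pa.
rewrite leq_eqVlt => /predU1P[ab|]; first by rewrite ab (negPf nPb) in Pa.
rewrite ltnS => ab; have [Pb|/IH[//|j /andP[aj jb] Pj]] := boolP (P b).
  by exists b; rewrite ?ab ?ltnSn ?Pb.
by exists j; rewrite // aj ltnW.
Qed.

(** If all [m = M i t] letters shortened [s] to [s'], the braid relation would write [s i] as [s']
    followed by [m - 1] letters, making it shorter than [s]. *)
Lemma wlen_strip s i t : i != t -> (wlen s <= wlen (rcons s i))%N ->
  ~~ (wlen (s ++ alt_word t i (M i t)) + M i t <= wlen s)%N.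
Proof.
move=> it si; apply/negP => strip.
have m2 := coxM.2.2 _ _ it; have sphi := sin_cox_angle it.
(* As [m phi = pi], the two coefficients are [sin (pi - phi) / sin phi = 1] and
   [sin pi / sin phi = 0], taken in the other order. *)
have root : word (rev (alt_word t i (M i t).-1)) *m sroot i = sroot (alt_letter t i (M i t).-1).
  rewrite alt_word_root // prednK ?(ltnW m2) //.
  set m := (M i t)%:R in sphi *; have m0 : m != 0 by rewrite pnatr_eq0; lia.
  have -> : (M i t).-1%:R * (pi / m) = pi - pi / m :> R.
    have -> : (M i t).-1%:R = m - 1 :> R by rewrite -subn1 natrB ?(ltnW m2).
    by field.
  have -> : m * (pi / m) = pi :> R by field.
  rewrite sinD sinN cosN sinpi cospi !mul0r scale0r add0r add0r mulN1r opprK.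
  by rewrite divff ?gt_eqF // scale1r.
have comm := word_refl_conj coxM root.
pose s' := s ++ alt_word t i (M i t); pose u := rev (alt_word t i (M i t).-1).
(* The last letter of the alternating word moves across [u] by [comm] and becomes [i]; what is left
   in front of [i] is [u^-1 u]. *)
have rE : word (rcons s i) = word (s' ++ u).
  rewrite /s' -{1}(prednK (ltnW m2)) alt_wordS -rcons_cat [RHS]word_cat word_rcons.
  rewrite [in RHS]word_rcons -[in RHS]mulmxA -comm word_cat.
  by rewrite -mulmxA (mulmxA _ (word u)) word_revr // mul1mx.
have := wlen_cat s' u; rewrite -(wlen_eq rE) size_rev size_mkseq /s'; lia.
Qed.

(* Strip the letters t, i, t, i, ... off the right of [s] as long as the length
   drops.  By induction what remains is nonnegative on [a_i] and [a_t], and fewer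
   than [M i t] letters were stripped, so that they send [a_i] to a nonnegative
   combination of [a_i] and [a_t]. *)
Lemma root_nonneg s i : (wlen s <= wlen (rcons s i))%N ->
  nonneg (word s *m sroot i).
Proof.
have [k] := ubnP (wlen s); elim: k s i => // k IH s i; rewrite ltnS => sk si.
have [r rE rs] := wlen_word s.
case: (lastP r) rE rs => [|r0 t] rE rs.
  by move=> l; rewrite -rs mul1mx mxE; case: (_ && _).
have rcl : (wlen (rcons s t) < wlen s)%N.
  rewrite -rE size_rcons ltnS; apply: wlen_le.
  by rewrite [RHS]word_rcons -rs word_rcons -mulmxA reflK // mulmx1.
have it : i != t by apply: contraTneq rcl => <-; rewrite -leqNgt.
pose Q j := (wlen (s ++ alt_word t i j) + j <= wlen s)%N.
have Q1 : Q 1 by rewrite /Q /alt_word /= cats1 addn1.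
have nQm : ~~ Q (M i t) by exact: wlen_strip.
have [j /andP[j1 jm] /andP[Qj nQj]] := last_true Q1 nQm (ltnW (coxM.2.2 _ _ it)).
pose v := s ++ alt_word t i j.
have vs : (wlen v < k)%N by rewrite /Q -/v in Qj; lia.
have vnext : nonneg (word v *m sroot (alt_letter t i j)).
  apply: IH => //; rewrite -ltnNge /Q alt_wordS -rcons_cat -/v in nQj.
  by rewrite /Q -/v in Qj; lia.
(* Appending the letter stripped last undoes that step. The length of [s] with only [j - 1] letters
   stripped is at least [wlen s - (j - 1)], hence larger than that of [v], and induction applies. *)
have vlast : nonneg (word v *m sroot (alt_letter t i j.+1)).
  apply: IH => //; have -> : wlen (rcons v (alt_letter t i j.+1)) = wlen (s ++ alt_word t i j.-1).
    apply: wlen_eq; rewrite word_rcons /v -[in alt_word _ _ j](prednK j1) alt_wordS.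
    rewrite -rcons_cat word_rcons -mulmxA -{3}(prednK j1) alt_letterSS.
    by rewrite reflK // mulmx1.
  have : (wlen s <= wlen (s ++ alt_word t i j.-1) + j.-1)%N.
    have -> : wlen s = wlen ((s ++ alt_word t i j.-1) ++ rev (alt_word t i j.-1)).
      by apply: wlen_eq; rewrite !word_cat -mulmxA word_revr // mulmx1.
    by apply: leq_trans (wlen_cat _ _) _; rewrite size_rev size_mkseq.
  by rewrite /Q -/v in Qj; lia.
have -> : word s = word v *m word (rev (alt_word t i j)).
  by rewrite word_cat -mulmxA word_revr // mulmx1.
rewrite -mulmxA alt_word_root // mulmxDr -!scalemxAr.
have sphi := sin_cox_angle it.
have m0 : 0 < (M i t)%:R :> R by rewrite ltr0n; lia.
have sge l : (l <= M i t)%N -> 0 <= sin (l%:R * (pi / (M i t)%:R)) / sin (pi / (M i t)%:R) :> R.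
  move=> lm; rewrite divr_ge0 ?(ltW sphi) // sin_ge0_pi //.
  rewrite mulr_ge0 ?ler0n //= ?divr_ge0 ?pi_ge0 ?(ltW m0) //=.
  rewrite mulrCA ler_piMr ?pi_ge0 // ler_pdivrMr // mul1r ler_nat //.
by apply: nonneg_comb => //; apply: sge; lia.
Qed.

(** If appending [i] shortens [s], then [s] is longer than [s i], and [- w a_i] is the image of
    [a_i] under [w s_i]. *)
Lemma root_sign s i : nonneg (word s *m sroot i) \/ nonneg (- (word s *m sroot i)).
Proof.
have [si|si] := leqP (wlen s) (wlen (rcons s i)); first by left; apply: root_nonneg.
right; rewrite -mulmxN -(refl_sroot R coxM) mulmxA -word_rcons.
apply: root_nonneg; rewrite (@wlen_eq (rcons (rcons s i) i) s) ?(ltnW si) //.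
by rewrite !word_rcons -mulmxA reflK // mulmx1.
Qed.

End Positivity.

(** * Positive definiteness and Coxeter forests *)

Section FiniteGroup.
Variables (R : realType) (n : nat) (M : 'M[nat]_n) (L : seq 'M[R]_n).
Hypothesis coxM : coxeter_matrix M.
Hypothesis irrM : coxeter_irreducible M.
Hypothesis uniqL : uniq L.
Hypothesis memL : forall w, w \in L <-> in_W M w.
Local Notation word := (word_mx R M).
Local Notation sroot := (@sroot R n).
Local Notation cform := (@cform R n M).

Lemma root_norm s i : cform (word s *m sroot i) (word s *m sroot i) = 1.
Proof. by rewrite cform_word // cform_sroot cox_form_diag. Qed.

Lemma root_nonneg_anti s i : nonneg (word s *m sroot i) ->
  nonneg (- (word s *m sroot i)) -> False.
Proof.
move=> pos neg; have := root_norm s i; rewrite (_ : _ *m _ = 0).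
  by rewrite cform0r => /esym/eqP; rewrite oner_eq0.
apply/colP => k; apply/eqP; rewrite [X in _ == X]mxE eq_le pos andbT.
by have := neg k; rewrite mxE oppr_ge0.
Qed.

(** [s_j] changes only the coordinate on [a_j]. If the image were negative, all other coordinates of
    the root would vanish, and a nonnegative multiple of [a_j] of norm 1 is [a_j]. *)
Lemma refl_nonneg s i j : nonneg (word s *m sroot i) ->
  word s *m sroot i != sroot j ->
  nonneg (simple_refl R M j *m (word s *m sroot i)).
Proof.
move=> pos; have nrm := root_norm s i.
have := root_sign R coxM (j :: s) i; rewrite /= -mulmxA.
move: (word s *m _) pos nrm => b pos nrm [//|]; rewrite refl_mulE => neg /eqP[].
have off k : k != j -> b k 0 = 0.
  move=> kj; apply/eqP; rewrite eq_le pos andbT -oppr_ge0.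
  by have := neg k; rewrite !mxE eqxx andbT (negPf kj) mulr0 subr0.
have bE : b = b j 0 *: sroot j.
  apply/colP => k; rewrite !mxE eqxx andbT; have [->|kj] := eqVneq k j.
    by rewrite mulr1.
  by rewrite mulr0 off.
move: nrm; rewrite bE cformZl cformZr cform_sroot cox_form_diag // mulr1.
move=> /eqP; rewrite -expr2 sqrf_eq1 => /orP[/eqP-> | /eqP bj].
  by rewrite scale1r.
by have := pos j; rewrite bj lerNr oppr0 ler10.
Qed.

Lemma big_reindex_L (V : nmodType) (g g' : 'M[R]_n -> 'M[R]_n) (F : 'M[R]_n -> V) :
  {in L, forall w, g w \in L} -> {in L, forall w, g' w \in L} ->
  {in L, cancel g g'} -> {in L, cancel g' g} ->
  \sum_(w <- L) F (g w) = \sum_(w <- L) F w.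
Proof.
move=> gL g'L gK g'K; rewrite -(big_map g xpredT F); apply: perm_big.
have inj : {in L &, injective g} by exact: can_in_inj gK.
apply: uniq_perm => [||w]; rewrite ?map_inj_in_uniq //.
by apply/mapP/idP => [[v vL ->]|wL]; [exact: gL | exists (g' w); rewrite ?g'K ?g'L].
Qed.

Lemma word_mem s : word s \in L.
Proof. by apply/memL; exists s. Qed.

Lemma mem_word w : w \in L -> exists s, w = word s.
Proof. by move/memL. Qed.

Lemma sum_mull (V : nmodType) s (F : 'M[R]_n -> V) :
  \sum_(w <- L) F (word s *m w) = \sum_(w <- L) F w.
Proof.
apply: (@big_reindex_L V (mulmx (word s)) (mulmx (word (rev s)))) => w wL.
- by have [t ->] := mem_word wL; rewrite -word_cat word_mem.
- by have [t ->] := mem_word wL; rewrite -word_cat word_mem.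
- by rewrite mulmxA word_rev // mul1mx.
- by rewrite mulmxA word_revr // mul1mx.
Qed.

Lemma sum_mulr (V : nmodType) s (F : 'M[R]_n -> V) :
  \sum_(w <- L) F (w *m word s) = \sum_(w <- L) F w.
Proof.
apply: (@big_reindex_L V (mulmx^~ (word s)) (mulmx^~ (word (rev s)))) => w wL.
- by have [t ->] := mem_word wL; rewrite -word_cat word_mem.
- by have [t ->] := mem_word wL; rewrite -word_cat word_mem.
- by rewrite -mulmxA word_revr // mulmx1.
- by rewrite -mulmxA word_rev // mulmx1.
Qed.

Lemma sum_inv (V : nmodType) (F : 'M[R]_n -> V) :
  \sum_(w <- L) F (invmx w) = \sum_(w <- L) F w.
Proof.
apply: (@big_reindex_L V invmx invmx) => w wL; rewrite ?invmxK //.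
all: by have [t ->] := mem_word wL; rewrite word_inv // word_mem.
Qed.

(** Summing the pullbacks of the standard dot product over the finite group gives an invariant inner
    product. *)
Definition avg_gram : 'M[R]_n := \sum_(w <- L) w^T *m w.

Definition avg_form (u v : 'cV[R]_n) : R := (u^T *m avg_gram *m v) 0 0.

Lemma avg_form_word s u v :
  avg_form (word s *m u) (word s *m v) = avg_form u v.
Proof.
rewrite /avg_form trmx_mul -!mulmxA (mulmxA _ (word s)) (mulmxA _ _ v).
suff -> : (word s)^T *m (avg_gram *m word s) = avg_gram by rewrite !mulmxA.
rewrite /avg_gram mulmx_suml mulmx_sumr.
rewrite -(sum_mulr s (fun w => w^T *m w)); apply: eq_bigr => w _.
by rewrite trmx_mul !mulmxA.
Qed.

Lemma avg_formC u v : avg_form u v = avg_form v u.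
Proof.
have -> : avg_form v u = ((v^T *m avg_gram *m u)^T) 0 0 by rewrite mxE.
rewrite !trmx_mul trmxK mulmxA; suff -> : avg_gram^T = avg_gram by [].
rewrite /avg_gram linear_sum; apply: eq_bigr => w _.
by rewrite /= trmx_mul trmxK.
Qed.

Lemma avg_form_gt0 u : u != 0 -> 0 < avg_form u u.
Proof.
move=> u0; have sq (w : 'M[R]_n) : (u^T *m (w^T *m w) *m u) 0 0 = \sum_k (w *m u) k 0 ^+ 2.
  rewrite mulmxA -trmx_mul -mulmxA mxE; apply: eq_bigr => k _.
  by rewrite [_^T _ _]mxE expr2.
have -> : avg_form u u = \sum_(w <- L) \sum_k (w *m u) k 0 ^+ 2.
  rewrite /avg_form /avg_gram mulmx_sumr mulmx_suml summxE.
  by apply: eq_bigr => w _; rewrite sq.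
rewrite (big_rem 1%:M) ?(word_mem [::]) //= mul1mx ltr_pwDl //; last first.
  by apply: sumr_ge0 => w _; apply: sumr_ge0 => k _; exact: sqr_ge0.
rewrite lt_neqAle sumr_ge0 ?andbT => [|k _]; last exact: sqr_ge0.
apply: contra u0; rewrite eq_sym psumr_eq0 => [/allP u0|k _]; last exact: sqr_ge0.
apply/eqP/colP => k; have /eqP := u0 k (mem_index_enum k).
by rewrite mxE => /eqP; rewrite sqrf_eq0 => /eqP.
Qed.

(** Invariance under [s_i], which negates [a_i], already determines the pairing with [a_i] up to the
    value on the diagonal. *)
Lemma avg_form_sroot i v :
  avg_form (sroot i) v = cform (sroot i) v * avg_form (sroot i) (sroot i).
Proof.
have := avg_form_word [:: i] (sroot i) (word [:: i] *m v).
rewrite mulmxA word1 reflK // mul1mx refl_sroot // refl_mulE.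
rewrite /avg_form linearN /= !mulNmx mxE mulmxBr -scalemxAr !mxE.
by lra.
Qed.

(** By symmetry of both forms, the diagonal values of [avg_form] agree along each edge, where
    [cform] is nonzero. Irreducibility makes them all equal, so [avg_form] is a positive multiple of
    [cform]. *)
Lemma cform_gt0 u : u != 0 -> 0 < cform u u.
Proof.
move=> u0; have [k _ | n0] := pickP 'I_n; last first.
  by case/eqP: u0; apply/colP => k; have := n0 k.
pose g i := avg_form (sroot i) (sroot i).
have g0 i : 0 < g i.
  apply: avg_form_gt0; apply/eqP => /(congr1 (fun v : 'cV_n => v i 0)).
  by rewrite !mxE !eqxx => /eqP; rewrite oner_eq0.
have gE i : g i = g k.
  have cl : fingraph.closed (fun a b => (2 < M a b)%N) [pred l | g l == g k].
    move=> a b ab; rewrite !inE; suff -> : g a = g b by [].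
    have := avg_formC (sroot a) (sroot b).
    rewrite (avg_form_sroot a (sroot b)) (avg_form_sroot b (sroot a)).
    rewrite !cform_sroot -!/(g _) cox_formC //.
    have : cox_form R M b a != 0.
      by rewrite cox_formC // lt_eqF //; have := cox_form_le R ab; lra.
    by move=> /mulfI /[apply].
  have := closed_connect cl (irrM k i); rewrite !inE eqxx.
  by move=> /esym/eqP.
suff: 0 < g k * cform u u by rewrite pmulr_rgt0.
have <- : avg_form u u = g k * cform u u; last exact: avg_form_gt0.
rewrite cform_sumE mulr_sumr {1}/avg_form -mulmxA mxE; apply: eq_bigr => l _.
rewrite [RHS]mulrCA -(gE l) [g l * _]mulrC -avg_form_sroot [u^T _ _]mxE.
by rewrite /avg_form trmx_delta -mulmxA -rowE [in RHS]mxE.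
Qed.

(* A subgraph of minimal degree at least 2 would carry the isotropic-or-worse
   vector [\sum_(i in S) a_i], so finite Coxeter graphs are forests. *)
Lemma leaf_exists (S : {set 'I_n}) i0 : i0 \in S ->
  exists2 v, v \in S &
    exists u, forall j, j \in S -> j != v -> j != u -> M v j = 2%N.
Proof.
move=> i0S.
have [/existsP[v /andP[vS /existsP[u /forallP H]]]|none] :=
  boolP [exists v, (v \in S) && [exists u, [forall j, [==> j \in S, j != v, j != u => M v j == 2%N]]]].
  exists v => //; exists u => j jS jv ju; apply/eqP.
  by have := H j; rewrite jS jv ju.
exfalso; pose x : 'cV[R]_n := \sum_(i in S) sroot i.
have nbr v u : v \in S -> exists2 j, (j \in S) && (j != v) & (j != u) && (2 < M v j)%N.
  move=> vS; move: none; rewrite negb_exists => /forallP/(_ v).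
  rewrite vS /= negb_exists => /forallP/(_ u); rewrite negb_forall => /existsP[j].
  rewrite !negb_imply => /and4P[jS jv ju Mvj]; exists j; rewrite ?jS ?jv ?ju //=.
  by rewrite ltn_neqAle eq_sym Mvj coxM.2.2 // eq_sym.
have x0 : x != 0.
  apply/eqP => /(congr1 (fun v : 'cV_n => v i0 0)); rewrite summxE mxE (bigD1 i0) //=.
  rewrite mxE !eqxx big1 ?addr0 => [/eqP|k /andP[_ ki]]; first by rewrite oner_eq0.
  by rewrite mxE eq_sym (negPf ki).
have := cform_gt0 x0; apply/negP; rewrite -leNgt.
rewrite {1}/x (big_morph (cform^~ x) (fun u v => cformDl M u v x) (_ : cform 0 x = 0)); last first.
  by rewrite cformC // cform0r.
apply: sumr_le0 => v vS; rewrite cform_sumr (bigD1 v) //= cform_sroot cox_form_diag //.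
(* Two distinct neighbours of [v] in [S] contribute at most [- 1 / 2] each and cancel the diagonal
   entry 1. *)
have [j /andP[jS jv] /andP[_ Mj]] := nbr v v vS.
have [k /andP[kS kv] /andP[kj Mk]] := nbr v j vS.
rewrite (bigD1 j) ?jS //= (bigD1 k) ?kS ?kv //= !cform_sroot.
have := cox_form_le R Mj; have := cox_form_le R Mk.
set T := (X in _ + (_ + (_ + X)) <= _); suff : T <= 0 by lra.
apply: sumr_le0 => l /andP[/andP[/andP[_ lv] _] _].
by rewrite cform_sroot cox_form_le0 // eq_sym.
Qed.

End FiniteGroup.

(** * Conjugacy of Coxeter words *)

Section CoxeterWords.
Variables (n : nat) (M : 'M[nat]_n).
Hypothesis coxM : coxeter_matrix M.

(** Rotating a word conjugates its product, and exchanging commuting letters preserves it. Each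
    constructor prepends one step to a chain, so that inductions follow the moves one by one. *)
Inductive cox_equiv : seq 'I_n -> seq 'I_n -> Prop :=
| cox_equiv_refl s : cox_equiv s s
| cox_equiv_rot s t u : cox_equiv (t ++ s) u -> cox_equiv (s ++ t) u
| cox_equiv_swap s x y t u : M x y = 2%N ->
    cox_equiv (s ++ y :: x :: t) u -> cox_equiv (s ++ x :: y :: t) u.

Lemma cox_equiv_trans s t u : cox_equiv s t -> cox_equiv t u -> cox_equiv s u.
Proof.
move=> st; elim: st u => // [s' t' u' _ IH u /IH | s' x y t' u' xy _ IH u /IH].
  exact: cox_equiv_rot.
exact: cox_equiv_swap.
Qed.

Lemma cox_equiv_perm s t : cox_equiv s t -> perm_eq s t.
Proof.
elim=> // [s' t' u _ | s' x y t' u _ _]; first by rewrite perm_catC.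
apply: perm_trans; rewrite perm_cat2l.
by rewrite -[x :: y :: t']/([:: x; y] ++ t') -[y :: x :: t']/([:: y; x] ++ t')
  perm_cat2r; apply/permP => a /=; rewrite !addn0 addnC.
Qed.

Lemma cox_equiv_moveR p v q r : {in q, forall x, M v x = 2%N} ->
  cox_equiv (p ++ v :: q ++ r) (p ++ q ++ v :: r).
Proof.
elim: q p => [|x q IH] p H; first exact: cox_equiv_refl.
apply: cox_equiv_swap; first by apply: H; rewrite mem_head.
rewrite /= -cat_rcons -[X in cox_equiv _ X]cat_rcons; apply: IH => y yq.
by apply: H; rewrite inE yq orbT.
Qed.

Lemma cox_equiv_moveL p v q r : {in q, forall x, M v x = 2%N} ->
  cox_equiv (p ++ q ++ v :: r) (p ++ v :: q ++ r).
Proof.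
elim/last_ind: q r => [|q x IH] r H; first exact: cox_equiv_refl.
rewrite cat_rcons catA; apply: cox_equiv_swap.
  by rewrite coxM.2.1; apply: H; rewrite mem_rcons mem_head.
rewrite -catA cat_rcons; apply: IH => y yq.
by apply: H; rewrite mem_rcons inE yq orbT.
Qed.

Definition insert_after (u v : 'I_n) (s : seq 'I_n) :=
  flatten [seq if x == u then [:: u; v] else [:: x] | x <- s].

Lemma insert_after_cat u v s t :
  insert_after u v (s ++ t) = insert_after u v s ++ insert_after u v t.
Proof. by rewrite /insert_after map_cat flatten_cat. Qed.

Lemma insert_after_cons u v x s : insert_after u v (x :: s) =
  (if x == u then [:: u; v] else [:: x]) ++ insert_after u v s.
Proof. by []. Qed.

Lemma insert_after_id u v s : u \notin s -> insert_after u v s = s.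
Proof.
elim: s => // x s IH; rewrite inE negb_or eq_sym => /andP[/negPf xu us].
by rewrite insert_after_cons xu IH.
Qed.

Lemma insert_after_split u v p q : u \notin p -> u \notin q ->
  insert_after u v (p ++ u :: q) = p ++ u :: v :: q.
Proof.
by move=> up uq; rewrite insert_after_cat insert_after_cons eqxx !insert_after_id.
Qed.

(* Equivalences lift along the insertion of a leaf [v] next to its neighbour [u]. *)
Lemma cox_equiv_insert_after u v s t : cox_equiv s t ->
  {in s, forall x, x != u -> M v x = 2%N} ->
  cox_equiv (insert_after u v s) (insert_after u v t).
Proof.
elim=> [s' _ | s' t' r _ IH H | s' x y t' r xy _ IH H]; first exact: cox_equiv_refl.
  rewrite insert_after_cat; apply: cox_equiv_rot; rewrite -insert_after_cat.
  by apply: IH => x xts; apply: H; rewrite mem_cat orbC -mem_cat.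
have Hx : x != u -> M v x = 2%N by apply: H; rewrite mem_cat !inE eqxx orbT.
have Hy : y != u -> M v y = 2%N by apply: H; rewrite mem_cat !inE eqxx !orbT.
have xNy : x != y by apply: contra_eqN xy => /eqP->; rewrite coxM.1.
apply: cox_equiv_trans (IH _); last first.
  by move=> z zs; apply: H; move: zs; rewrite !(mem_cat, inE); case/or4P => ->; rewrite ?orbT.
rewrite !insert_after_cat !insert_after_cons.
(* When one of the exchanged letters is [u], the other one has to pass both [u] and [v], which takes
   two commutations. *)
have [xu | xu] := eqVneq x u.
  have yu : y != u by rewrite -xu eq_sym.
  rewrite (negPf yu) -xu /= -cat_rcons.
  apply: cox_equiv_swap; first exact: Hy.
  rewrite cat_rcons; apply: cox_equiv_swap => //; exact: cox_equiv_refl.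
have [yu | yu] := eqVneq y u; last by apply: cox_equiv_swap => //; exact: cox_equiv_refl.
rewrite -yu /=; apply: cox_equiv_swap => //; rewrite -cat_rcons.
apply: cox_equiv_swap; first by rewrite coxM.2.1; exact: Hx.
by rewrite cat_rcons; exact: cox_equiv_refl.
Qed.

Definition indep (s : seq 'I_n) := {in s &, forall x y, x != y -> M x y = 2%N}.

Lemma indep_cons v s : {in s, forall x, M v x = 2%N} -> indep s -> indep (v :: s).
Proof.
move=> vs ss x y; rewrite !inE => /predU1P[-> | xs] /predU1P[-> | ys] //.
- by rewrite eqxx.
- by move=> _; exact: vs.
- by move=> _; rewrite coxM.2.1; exact: vs.
- exact: ss.
Qed.

Hypothesis leaf : forall (S : {set 'I_n}) i0, i0 \in S ->
  exists2 v, v \in S &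
    exists u, forall j, j \in S -> j != v -> j != u -> M v j = 2%N.

(** Induction on the size: remove a leaf [v], sort the rest into two independent halves, reinsert
    [v] next to its neighbour [u], and move it into the half that does not contain [u]. *)
Lemma bipartite_word s : uniq s ->
  exists b w, [/\ cox_equiv s (b ++ w), indep b & indep w].
Proof.
have [m] := ubnP (size s); elim: m s => // m IH s; rewrite ltnS => sm us.
case: s => [|i0 s0] in us sm *; first by exists [::], [::]; split => //; exact: cox_equiv_refl.
set s := i0 :: s0 in us sm *.
have [v vs [u0 Hu0]] : exists2 v, v \in s &
    exists u, forall j, j \in s -> j != v -> j != u -> M v j = 2%N.
  have [|v vS [u Hu]] := @leaf [set x in s] i0; first by rewrite inE mem_head.
  rewrite inE in vS; exists v => //; exists u => j js; apply: Hu.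
  by rewrite inE.
have [p [q sE]] : exists p q, s = p ++ v :: q.
  by case/splitPr: vs => p q; exists p, q.
move: us sm vs Hu0; rewrite {}sE => us sm vs Hu0.
pose s' := q ++ p.
have us' : uniq (v :: s') by rewrite -cat_cons uniq_catC.
have /andP[vs' {}us'] : (v \notin s') && uniq s' by [].
have ss' : cox_equiv (p ++ v :: q) (v :: s').
  by apply: cox_equiv_rot; exact: cox_equiv_refl.
have sm' : (size s' < m)%N by move: sm; rewrite /s' !size_cat /=; lia.
have H0 x : x \in s' -> x != u0 -> M v x = 2%N.
  move=> xs'; apply: Hu0; last by apply: contraNneq vs' => <-.
  by move: xs'; rewrite !(mem_cat, inE); case/orP => ->; rewrite ?orbT.
case s'0 : s' => [|x0 s1].
  exists [:: v], [::]; split=> //; last by move=> x y; rewrite !inE => /eqP-> /eqP->; rewrite eqxx.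
  by rewrite s'0 in ss'.
(* If the candidate neighbour does not occur in [s'], then [v] commutes with all of [s'] and any
   letter can serve as [u]. *)
have [u us'u H] : exists2 u, u \in s' & forall x, x \in s' -> x != u -> M v x = 2%N.
  have [u0s|u0s] := boolP (u0 \in s'); first by exists u0.
  exists x0 => [|x xs _]; first by rewrite s'0 mem_head.
  by apply: H0 => //; apply: contraNneq u0s => <-.
(* Rotate [v] to the end, then slide it left until it stands just after [u]. *)
have {}s'0 : cox_equiv (v :: s') (insert_after u v s').
  case/splitPr: us'u (us') H => p' q'; rewrite cat_uniq /= => /and4P[_ /norP[up' _] uq' _] H.
  rewrite insert_after_split // -cat1s; apply: cox_equiv_rot; rewrite -catA /= -cat_rcons.
  apply: cox_equiv_trans (cox_equiv_moveL _ [::] _) _; last by rewrite cats0 cat_rcons; exact: cox_equiv_refl.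
  move=> x xq; apply: H; first by rewrite mem_cat inE xq !orbT.
  by apply: contraNneq uq' => <-.
have [b [w [s'bw ib iw]]] := IH s' sm' us'.
have s'i := cox_equiv_trans ss' (cox_equiv_trans s'0 (cox_equiv_insert_after s'bw H)).
have pbw := cox_equiv_perm s'bw.
have ubw : uniq (b ++ w) by rewrite -(perm_uniq pbw).
have {}H x : x \in b ++ w -> x != u -> M v x = 2%N by rewrite -(perm_mem pbw); exact: H.
have : u \in b ++ w by rewrite -(perm_mem pbw).
(* If [u] is in [b], then [v] slides right to the head of [w]. If [u] is in [w], then [v] slides to
   the end of the word and is rotated to the head of [b]. *)
rewrite mem_cat => /orP[]/splitPr uE.
  case: uE ib s'i ubw H => b1 b2 ib s'i ubw H; exists (b1 ++ u :: b2), (v :: w).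
  move: ubw; rewrite -catA /= uniq_catC /= => ubw.
  have /andP[unot _] := ubw.
  have Hin x : x \in b2 ++ w -> M v x = 2%N.
    move=> xx; apply: H; first by move: xx; rewrite !(mem_cat, inE) => /orP[]->; rewrite ?orbT.
    apply: contraNneq unot => <-; rewrite mem_cat xx //.
  split=> //; last first.
    by apply: indep_cons => // x xw; apply: Hin; rewrite mem_cat xw orbT.
  apply: cox_equiv_trans s'i _; rewrite -!catA /= insert_after_split; last 2 first.
  - by move: unot; rewrite mem_cat negb_or => /andP[].
  - by move: unot; rewrite mem_cat negb_or => /andP[].
  rewrite -!(cat_rcons u); apply: cox_equiv_moveR => x xb.
  by apply: Hin; rewrite mem_cat xb.
case: uE iw s'i ubw H => w1 w2 iw s'i ubw H; exists (v :: b), (w1 ++ u :: w2).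
move: ubw; rewrite catA uniq_catC /= => /andP[unot _].
have Hin x : x \in w2 ++ (b ++ w1) -> M v x = 2%N.
  move=> xx; apply: H; last by apply: contraNneq unot => <-.
  by move: xx; rewrite !(mem_cat, inE) => /or3P[]->; rewrite ?orbT.
split=> //; last first.
  by apply: indep_cons => // x xb; apply: Hin; rewrite !mem_cat xb orbT.
apply: cox_equiv_trans s'i _; rewrite catA insert_after_split; last 2 first.
- by move: unot; rewrite mem_cat negb_or => /andP[].
- by move: unot; rewrite mem_cat negb_or => /andP[].
have E : cox_equiv ((b ++ w1) ++ u :: v :: w2) (((b ++ w1) ++ u :: w2) ++ [:: v]).
  rewrite -[X in cox_equiv _ X]catA /= -!(cat_rcons u).
  have := @cox_equiv_moveR (rcons (b ++ w1) u) v w2 [::]; rewrite cats0; apply=> x xw.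
  by apply: Hin; rewrite mem_cat xw.
by apply: cox_equiv_trans E _; apply: cox_equiv_rot; rewrite -!catA /=; exact: cox_equiv_refl.
Qed.

End CoxeterWords.

(** * Equivalent words have conjugate products, hence equal orders *)

Section CoxeterOrder.
Variables (R : realType) (n : nat) (M : 'M[nat]_n).
Hypothesis coxM : coxeter_matrix M.
Local Notation word := (word_mx R M).

Lemma refl_comm x y : M x y = 2%N ->
  simple_refl R M x *m simple_refl R M y = simple_refl R M y *m simple_refl R M x.
Proof.
move=> xy; apply: mx_ext => v; rewrite -!mulmxA !refl_mulE.
rewrite !(cformDr, cformNr, cformZr) !cform_sroot (cox_formC R coxM y x).
have -> : cox_form R M x y = 0 by rewrite /cox_form xy cos_pihalf oppr0.
by rewrite !mulr0 !subr0 addrAC.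
Qed.

Lemma cox_equiv_conj s t : cox_equiv M s t -> exists g, word s = word g *m word t *m word (rev g).
Proof.
elim=> [u | u v r _ [g gE] | u x y v r xy _ [g gE]].
- by exists [::]; rewrite mul1mx mulmx1.
- exists (u ++ g); rewrite rev_cat !word_cat.
  have -> : word u *m word g *m word r *m (word (rev g) *m word (rev u)) =
    word u *m (word g *m word r *m word (rev g)) *m word (rev u) by rewrite !mulmxA.
  by rewrite -gE word_cat !mulmxA -mulmxA word_revr // mulmx1.
exists g; rewrite -gE !word_cat /= !mulmxA.
by rewrite -(mulmxA (word u)) refl_comm // mulmxA.
Qed.

Lemma mxpow_word s k : exists t, mxpow (word s) k = word t.
Proof.
elim: k => [|k [t IH]]; first by exists [::].
by exists (s ++ t); rewrite word_cat -IH.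
Qed.

Lemma cox_equiv_mxpow1 s t k : cox_equiv M s t ->
  mxpow (word s) k = 1%:M <-> mxpow (word t) k = 1%:M.
Proof.
move=> /cox_equiv_conj[g gE].
have E : mxpow (word s) k = word g *m mxpow (word t) k *m word (rev g).
  elim: k => [|k IH]; first by rewrite /mxpow /= mulmx1 word_revr.
  have -> : mxpow (word s) k.+1 = word s *m mxpow (word s) k by [].
  rewrite IH gE -!mulmxA; congr (_ *m (_ *m _)).
  by rewrite !mulmxA word_rev // mul1mx.
rewrite E; split=> [e | ->]; last by rewrite mulmx1 word_revr.
have : word (rev g) *m (word g *m mxpow (word t) k *m word (rev g)) *m word g = 1%:M.
  by rewrite e mulmx1 word_rev.
by rewrite !mulmxA word_rev // mul1mx -mulmxA word_rev // mulmx1.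
Qed.

End CoxeterOrder.

(** * Perron-Frobenius vectors *)

Section Perron.

(** The first-order condition at a maximum. At [t = a / (|b| + 1)] the expression equals
    [t^2 (2 (|b| + 1) + b)], which is positive unless [a = 0]. *)
Lemma lin_coef_eq0 (R : realType) (a b : R) :
  (forall t, 2 * t * a + t ^+ 2 * b <= 0) -> a = 0.
Proof.
move=> H; apply/eqP; apply: contraT => a0.
have c0 : 0 < `|b| + 1 by rewrite ltr_wpDl.
have := H (a / (`|b| + 1)).
have -> : 2 * (a / (`|b| + 1)) * a + (a / (`|b| + 1)) ^+ 2 * b =
  (a / (`|b| + 1)) ^+ 2 * (2 * (`|b| + 1) + b) by field; rewrite gt_eqF.
rewrite pmulr_rle0; last by rewrite exprn_even_gt0 //= mulf_neq0 // invr_neq0 ?gt_eqF.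
by have := ler_norm (- b); rewrite normrN; have := normr_ge0 b; lra.
Qed.

Lemma continuous_mulr (R : realType) (T : topologicalType) (f g : T -> R) :
  continuous f -> continuous g -> continuous (fun x => f x * g x).
Proof. by move=> cf cg x; apply: cvgM; [exact: cf | exact: cg]. Qed.

Variables (R : realType) (n : nat) (A : 'M[R]_n).
Hypothesis symA : forall i j, A i j = A j i.
Hypothesis A_ge0 : forall i j, 0 <= A i j.

Definition rayleigh (x : 'rV[R]_n) := \sum_i \sum_j A i j * x 0 i * x 0 j.
Definition sqnorm (x : 'rV[R]_n) := \sum_i x 0 i ^+ 2.

(** The unit sphere is closed and lies in a cube, hence is compact, and the quadratic form is
    continuous. *)
Lemma rayleigh_max : (0 < n)%N -> exists2 p : 'rV[R]_n,
  sqnorm p = 1 & forall x, sqnorm x = 1 -> rayleigh x <= rayleigh p.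
Proof.
move=> n0; pose K : set 'rV[R]_n := [set x | sqnorm x = 1]%classic.
have cc i : continuous (fun x : 'rV[R]_n => x 0 i) by exact: coord_continuous.
have cN : continuous sqnorm.
  by apply: (continuous_big add_continuous) => i _; apply: continuous_mulr.
have cQ : continuous rayleigh.
  apply: (continuous_big add_continuous) => i _.
  apply: (continuous_big add_continuous) => j _.
  by do 2?apply: continuous_mulr => //; exact: cst_continuous.
have K0 : (K !=set0)%classic.
  exists (delta_mx 0 (Ordinal n0)); rewrite /K /= /sqnorm (bigD1 (Ordinal n0)) //=.
  by rewrite mxE !eqxx expr1n big1 ?addr0 // => i /negPf i0; rewrite mxE i0 andbF expr0n.
have Kc : compact K.
  have cube : compact [set v : 'rV[R]_n | forall i, v ord0 i \in `[- 1, 1]%R]%classic.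
    apply: (@rV_compact R n (fun=> [set` `[- 1, 1]%R]%classic)) => _.
    exact: segment_compact.
  apply: (subclosed_compact _ cube).
    exact: (iffLR (continuous_closedP _) cN _ (closed_eq (y := 1))).
  move=> v; rewrite /K /= => v1 i; rewrite in_itv /= -ler_norml.
  rewrite -(@ler_pXn2r _ 2%N) ?nnegrE //= expr1n -normrX ger0_norm ?sqr_ge0 //.
  by rewrite -v1 /sqnorm (bigD1 i) //= lerDl sumr_ge0 // => j _; exact: sqr_ge0.
have [p pK pmax] := EVT_max_rV K0 Kc (continuous_subspaceT cQ).
exists p => [|x x1]; first by move: pK; rewrite inE.
by apply: pmax; rewrite inE.
Qed.

Lemma sqnorm_eq0 x : (sqnorm x == 0) = (x == 0).
Proof.
rewrite /sqnorm psumr_eq0 => [|i _]; last exact: sqr_ge0.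
apply/allP/eqP => [x0 | -> i _]; last by rewrite /= mxE expr0n eqxx.
apply/rowP => i; have := x0 i (mem_index_enum i).
by rewrite mxE /= sqrf_eq0 => /eqP.
Qed.

Lemma sqnormZ a x : sqnorm (a *: x) = a ^+ 2 * sqnorm x.
Proof. by rewrite /sqnorm mulr_sumr; apply: eq_bigr => i _; rewrite mxE exprMn. Qed.

Lemma rayleighZ a x : rayleigh (a *: x) = a ^+ 2 * rayleigh x.
Proof.
rewrite /rayleigh mulr_sumr; apply: eq_bigr => i _; rewrite mulr_sumr.
by apply: eq_bigr => j _; rewrite !mxE; ring.
Qed.

Lemma rayleigh_le p : sqnorm p = 1 ->
  (forall x, sqnorm x = 1 -> rayleigh x <= rayleigh p) ->
  forall x, rayleigh x <= rayleigh p * sqnorm x.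
Proof.
move=> p1 pmax x; have [->|x0] := eqVneq x 0.
  by rewrite -[0](scale0r (0 : 'rV[R]_n)) rayleighZ sqnormZ expr0n !mul0r mulr0.
have N0 : 0 < sqnorm x.
  by rewrite lt_neqAle eq_sym sqnorm_eq0 x0 /= sumr_ge0 // => i _; exact: sqr_ge0.
pose a := (Num.sqrt (sqnorm x))^-1.
have a2 : a ^+ 2 = (sqnorm x)^-1 by rewrite exprVn sqr_sqrtr // ltW.
have := pmax (a *: x); rewrite sqnormZ rayleighZ a2 mulVf ?gt_eqF // => /(_ erefl).
by rewrite mulrC ler_pdivrMr.
Qed.

Lemma rayleigh_shift p i t : rayleigh (p + t *: delta_mx 0 i) =
  rayleigh p + 2 * t * (\sum_j A i j * p 0 j) + t ^+ 2 * A i i.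
Proof.
have sum_delta (f : 'I_n -> R) : \sum_j f j * (j == i)%:R = f i.
  rewrite (bigD1 i) //= eqxx mulr1 big1 ?addr0 // => j /negPf->.
  by rewrite mulr0.
rewrite /rayleigh.
rewrite (eq_bigr (fun k => \sum_j A k j * p 0 k * p 0 j
  + t * \sum_j (A k j * p 0 k) * (j == i)%:R
  + (t * (\sum_j A k j * p 0 j) + t ^+ 2 * \sum_j A k j * (j == i)%:R) * (k == i)%:R)).
  rewrite !big_split /= sum_delta -mulr_sumr.
  under [X in _ + t * X + _]eq_bigr do rewrite sum_delta symA.
  by rewrite sum_delta; ring.
move=> k _; rewrite !mulr_sumr mulrDl !mulr_suml -!big_split /=.
apply: eq_bigr => j _.
by rewrite !mxE !eqxx /=; ring.
Qed.

Lemma sqnorm_shift p i t :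
  sqnorm (p + t *: delta_mx 0 i) = sqnorm p + 2 * t * p 0 i + t ^+ 2.
Proof.
rewrite /sqnorm (bigD1 i) //= [in RHS](bigD1 i) //= !mxE !eqxx.
rewrite (eq_bigr (fun j => p 0 j ^+ 2)) /=; first by ring.
by move=> j /negPf ji; rewrite !mxE eqxx ji mulr0 addr0.
Qed.

(** Replacing a maximiser on the sphere by its absolute values does not decrease the form, because
    [A] is nonnegative. The first-order condition makes the result an eigenvector, and its zero set
    is closed under adjacency, hence empty by connectedness. *)
Lemma perron_frobenius (i0 : 'I_n) :
  (forall i j, connect (fun a b => 0 < A a b) i j) ->
  exists p : 'I_n -> R, exists mu : R,
    (forall i, 0 < p i) /\ (forall i, \sum_j A i j * p j = mu * p i).
Proof.
move=> conn; have n0 : (0 < n)%N by apply: leq_ltn_trans (ltn_ord i0).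
have [q q1 qmax] := rayleigh_max n0.
pose p : 'rV[R]_n := \row_(i < n) `|q 0 i|.
have p1 : sqnorm p = 1.
  by rewrite -q1; apply: eq_bigr => i _; rewrite mxE -normrX ger0_norm ?sqr_ge0.
have pq : rayleigh q <= rayleigh p.
  apply: ler_sum => i _; apply: ler_sum => j _; rewrite !mxE -!mulrA ler_wpM2l //.
  by rewrite -normrM ler_norm.
have pmax x : sqnorm x = 1 -> rayleigh x <= rayleigh p.
  by move=> /qmax /le_trans; apply.
have le := rayleigh_le p1 pmax.
have pE i : \sum_j A i j * p 0 j = rayleigh p * p 0 i.
  apply/eqP; rewrite -subr_eq0; apply/eqP.
  apply: (@lin_coef_eq0 _ _ (A i i - rayleigh p)) => t.
  have := le (p + t *: delta_mx 0 i); rewrite rayleigh_shift sqnorm_shift p1.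
  by lra.
have p_ge0 i : 0 <= p 0 i by rewrite mxE.
exists (p 0), (rayleigh p); split=> // i.
rewrite lt_neqAle p_ge0 andbT eq_sym; apply/eqP => pi0.
have cl : fingraph.closed (fun a b => 0 < A a b) [pred l | p 0 l == 0].
  have step a b : 0 < A a b -> p 0 a == 0 -> p 0 b == 0.
    move=> ab /eqP pa; have := pE a; rewrite pa mulr0 => /eqP.
    rewrite psumr_eq0 => [/allP/(_ b (mem_index_enum b))|k _]; last exact: mulr_ge0.
    by rewrite mulf_eq0 gt_eqF.
  by move=> a b ab; rewrite !inE; apply/idP/idP; apply: step; rewrite // symA.
suff p0 : p = 0.
  have /eqP s0 : sqnorm p == 0 by rewrite sqnorm_eq0 p0.
  by move: p1; rewrite s0 => /esym/eqP; rewrite oner_eq0.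
apply/rowP => k; rewrite [RHS]mxE; have := closed_connect cl (conn i k).
by rewrite !inE pi0 eqxx => /esym/eqP.
Qed.

End Perron.

(** * The Coxeter plane *)

(** Within one period a sinusoid cannot drop from positive to negative twice, over the steps from
    [t] to [t + d] and from [t + u] to [t + u + d]. *)
Lemma sinusoid_sign_changes (R : realType) (P Q t d u : R) :
  let f x := P * sin x + Q * cos x in
  0 < d -> d <= u -> u + d <= pi *+ 2 ->
  0 < f t -> f (t + d) < 0 -> 0 < f (t + u) -> f (t + u + d) < 0 -> False.
Proof.
move=> f d0 du ud f0 fd fu fud.
(* The middle of three values is a combination of the outer two, with coefficients of known sign as
   long as the gaps are at most [pi]. *)
have interp x y z : f (x + y) * sin (y + z) = f x * sin z + f (x + y + z) * sin y.
  have {2}-> : x = x + y - y by rewrite addrK.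
  move: (x + y) => v.
  by rewrite /f (sinD v z) (cosD v z) sinB cosB sinD; ring.
have {du} du : d < u.
  by rewrite lt_neqAle du andbT; apply/eqP => e; move: fd fu; rewrite -e; lra.
have [up|up] := leP u pi.
  (* The values at [t], [t + d], [t + u] would be positive, negative, positive within half a
     period. *)
  have := interp t d (u - d); rewrite -addrA [d + (u - d)]addrC subrK.
  have s1 : 0 <= sin (u - d) by apply: sin_ge0_pi; apply/andP; split; lra.
  have s2 : 0 < sin d by apply: sin_gt0_pi; apply/andP; split; lra.
  have s3 : 0 <= sin u by apply: sin_ge0_pi; apply/andP; split; lra.
  by nra.
(* For [u > pi] the first point is replaced by its antipode: [t + pi], [t + u], [t + u + d] would
   give the signs negative, positive, negative. *)
have fpi : f (t + pi) < 0 by rewrite /f sinDpi cosDpi; move: f0; rewrite /f; lra.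
have := interp (t + pi) (u - pi) d.
have -> : t + pi + (u - pi) = t + u by ring.
have p2 : pi *+ 2 = pi + pi :> R by [].
have s1 : 0 <= sin (u - pi + d) by apply: sin_ge0_pi; apply/andP; split; lra.
have s2 : 0 < sin (u - pi) by apply: sin_gt0_pi; apply/andP; split; lra.
have s3 : 0 <= sin d by apply: sin_ge0_pi; apply/andP; split; lra.
by nra.
Qed.

Section CoxeterPlane.
Variables (R : realType) (n : nat) (M : 'M[nat]_n).
Hypothesis coxM : coxeter_matrix M.
Local Notation word := (word_mx R M).
Local Notation sroot := (@sroot R n).
Local Notation cform := (@cform R n M).
Hypothesis cform_pos : forall u, u != 0 -> 0 < cform u u.

Variables b w : seq 'I_n.
Hypothesis uniq_bw : uniq (b ++ w).
Hypothesis mem_bw : forall i, i \in b ++ w.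
Hypothesis indep_b : indep M b.
Hypothesis indep_w : indep M w.

Lemma cform_indep s i j : indep M s -> i \in s -> j \in s -> i != j ->
  cform (sroot i) (sroot j) = 0.
Proof.
by move=> ind si sj ij; rewrite cform_sroot /cox_form ind // cos_pihalf oppr0.
Qed.

(** The reflections in mutually orthogonal roots do not disturb one another, so all the projections
    are subtracted at once. *)
Lemma word_indep s v : uniq s -> indep M s ->
  word s *m v = v - \sum_(i <- s) (2 * cform (sroot i) v) *: sroot i.
Proof.
elim: s => [|i s IH] /= us ind; first by rewrite mul1mx big_nil subr0.
have /andP[is' {}us] := us; rewrite -mulmxA refl_mulE IH //; last first.
  by move=> x y xs ys; apply: ind; rewrite inE ?xs ?ys orbT.
rewrite big_cons opprD addrA [in RHS]addrAC; congr (_ - _ *: _); congr (_ * _).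
rewrite cformDr cformNr cform_sumr big_seq big1 ?subr0 // => j js.
rewrite cformZr (cform_indep ind) ?mulr0 ?mem_head ?inE ?js ?orbT //.
by apply: contraNneq is' => ->.
Qed.

Variables (p : 'I_n -> R) (phi : R).
Hypothesis p_gt0 : forall i, 0 < p i.
Hypothesis phi_gt0 : 0 < phi.
Hypothesis phi_le : phi <= pi / 2.
Hypothesis p_eigen : forall i,
  cform (sroot i) (\sum_k p k *: sroot k) = (1 - cos phi) * p i.

Definition half_sum (s : seq 'I_n) := \sum_(i <- s) p i *: sroot i.

Lemma half_sum_in s i : uniq s -> indep M s -> i \in s ->
  cform (sroot i) (half_sum s) = p i.
Proof.
move=> us ind si; rewrite /half_sum cform_sumr (bigD1_seq i) //=.
rewrite cformZr cform_sroot cox_form_diag // mulr1 big_seq_cond big1 ?addr0 //.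
by move=> j /andP[js ji]; rewrite cformZr (cform_indep ind) ?mulr0 // eq_sym.
Qed.

Lemma half_sumD : half_sum b + half_sum w = \sum_k p k *: sroot k.
Proof.
rewrite /half_sum -big_cat -big_enum; apply: perm_big.
by apply: uniq_perm; rewrite ?enum_uniq // => i; rewrite mem_enum mem_bw.
Qed.

Lemma uniq_b : uniq b.
Proof. by move: uniq_bw; rewrite cat_uniq => /and3P[]. Qed.

Lemma uniq_w : uniq w.
Proof. by move: uniq_bw; rewrite cat_uniq => /and3P[]. Qed.

Lemma half_sum_bw i : i \in b -> cform (sroot i) (half_sum w) = - (cos phi * p i).
Proof.
move=> ib; have := p_eigen i; rewrite -half_sumD cformDr half_sum_in ?uniq_b //.
by lra.
Qed.

Lemma half_sum_wb i : i \in w -> cform (sroot i) (half_sum b) = - (cos phi * p i).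
Proof.
move=> ib; have := p_eigen i; rewrite -half_sumD cformDr (half_sum_in uniq_w) //.
by lra.
Qed.

Lemma word_half_in s : uniq s -> indep M s -> word s *m half_sum s = - half_sum s.
Proof.
move=> us ind; rewrite word_indep //.
rewrite big_seq (eq_bigr (fun i => 2 *: (p i *: sroot i))) => [|i si].
  by rewrite -big_seq -scaler_sumr -/(half_sum s) scaler_nat mulr2n opprD addrA subrr sub0r.
by rewrite half_sum_in // scalerA.
Qed.

Lemma word_half_out s t : uniq s -> indep M s ->
  {in s, forall i, cform (sroot i) (half_sum t) = - (cos phi * p i)} ->
  word s *m half_sum t = half_sum t + (2 * cos phi) *: half_sum s.
Proof.
move=> us ind H; rewrite word_indep // /half_sum scaler_sumr -sumrN; congr (_ + _).
rewrite big_seq [RHS]big_seq; apply: eq_bigr => i si.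
by rewrite H // scalerA -scaleNr; congr (_ *: _); ring.
Qed.

(** The Coxeter plane, parametrised so that the factor [b] acts on the parameter as the reflection
    [t -> pi - 2 phi - t], and [c] as the translation by [- 2 phi]. *)
Definition plane t := sin t *: half_sum b + sin (t + phi) *: half_sum w.

Lemma word_b_plane t : word b *m plane t =
  sin (t + phi *+ 2) *: half_sum b + sin (t + phi) *: half_sum w.
Proof.
rewrite /plane mulmxDr -!scalemxAr word_half_in ?uniq_b //.
rewrite word_half_out ?uniq_b //; last exact: half_sum_bw.
have -> : t + phi *+ 2 = t + phi + phi by rewrite mulr2n addrA.
have -> : sin t = sin (t + phi - phi) by rewrite addrK.
move: (half_sum b) (half_sum w) => x y; apply/colP => k; rewrite !mxE.
by rewrite !(sinD, cosD) sinN cosN; ring.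
Qed.

Lemma word_b_planeR t : word b *m plane t = plane (pi - phi *+ 2 - t).
Proof.
rewrite word_b_plane /plane.
have -> : pi - phi *+ 2 - t = pi - (t + phi *+ 2) by ring.
have -> : pi - (t + phi *+ 2) + phi = pi - (t + phi) by rewrite mulr2n; ring.
by rewrite !(sinB _ _, sinpi, cospi) !mul0r !sub0r !mulN1r !opprK.
Qed.

Lemma word_wb_plane t : word w *m (word b *m plane t) = plane (t + phi *+ 2).
Proof.
rewrite word_b_plane mulmxDr -!scalemxAr word_half_in ?uniq_w //.
rewrite word_half_out ?uniq_w //; last exact: half_sum_wb.
rewrite /plane.
have -> : sin (t + phi) = sin (t + phi *+ 2 - phi) by rewrite mulr2n; congr sin; ring.
move: (half_sum b) (half_sum w) => x y; apply/colP => k; rewrite !mxE.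
by rewrite (sinD (t + phi *+ 2) phi) (sinD _ (- phi)) sinN cosN; ring.
Qed.

Lemma word_involutive s (v : 'cV[R]_n) : uniq s -> indep M s -> word s *m (word s *m v) = v.
Proof.
move=> us ind; rewrite [X in word s *m X]word_indep // mulmxBr word_indep //.
set S := \sum_(i <- s) _; suff -> : word s *m S = - S by rewrite opprK subrK.
rewrite mulmx_sumr -sumrN; apply: eq_big_seq => i si.
rewrite -scalemxAr -scalerN; congr (_ *: _).
rewrite word_indep // (bigD1_seq i) //= cform_sroot cox_form_diag //.
rewrite big_seq_cond big1 => [|j /andP[js ji]].
  by rewrite addr0 mulr1 scaler_nat mulr2n opprD addrA subrr sub0r.
by rewrite (cform_indep ind) // mulr0 scale0r.
Qed.

Local Notation c := (word (b ++ w)).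

(** Both halves are involutions, so the product of [w] and [b] in the opposite order is the inverse
    of [c]. *)
Lemma cox_plane t : c *m plane t = plane (t - phi *+ 2).
Proof.
rewrite -{1}(subrK (phi *+ 2) t) -word_wb_plane word_cat -mulmxA.
by rewrite word_involutive ?uniq_w // word_involutive ?uniq_b.
Qed.

Lemma coxpow_plane k t : mxpow c k *m plane t = plane (t - (phi *+ 2) *+ k).
Proof.
elim: k => [|k IH]; first by rewrite mul1mx subr0.
by rewrite /mxpow /= -/(mxpow c k) -mulmxA IH cox_plane mulrS; congr plane; ring.
Qed.

(** On this interval [cos t > 0] and [cos (t + phi) < 0]. These are the factors that decide the
    pairing with the simple roots of [w] and of [b], so [plane t] lies in the open fundamental
    chamber. *)
Definition in_sector t := (pi / 2 - phi < t) && (t < pi / 2).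

Lemma sin_phi : 0 < sin phi.
Proof. by apply: sin_gt0_pi; rewrite phi_gt0 /=; have := pi_gt0 R; have := phi_le; lra. Qed.

Lemma sroot_plane_b i t : i \in b ->
  cform (sroot i) (plane t) = - (p i * sin phi * cos (t + phi)).
Proof.
move=> ib; rewrite cformDr !cformZr half_sum_in ?uniq_b // half_sum_bw //.
by rewrite -{1}[t](addrK phi) sinB; ring.
Qed.

Lemma sroot_plane_w i t : i \in w ->
  cform (sroot i) (plane t) = p i * sin phi * cos t.
Proof.
move=> iw; rewrite cformDr !cformZr (half_sum_in uniq_w) // half_sum_wb //.
by rewrite sinD; ring.
Qed.

Lemma sroot_plane_gt0 i t : in_sector t -> 0 < cform (sroot i) (plane t).
Proof.
move=> /andP[t1 t2]; have p0 := pi_gt0 R; have p1 := phi_gt0; have p2 := phi_le.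
have := mem_bw i; rewrite mem_cat.
have psi : 0 < p i * sin phi by rewrite mulr_gt0 ?sin_phi.
case/orP => [ib|iw].
  rewrite sroot_plane_b // oppr_gt0 pmulr_rlt0 // -[t + phi](subrK pi) cosDpi.
  by rewrite oppr_lt0 cos_gt0_pihalf //; apply/andP; split; lra.
by rewrite sroot_plane_w // pmulr_rgt0 // cos_gt0_pihalf //; apply/andP; split; lra.
Qed.

Lemma root_plane_gt0 s i t : in_sector t -> nonneg (word s *m sroot i) ->
  0 < cform (word s *m sroot i) (plane t).
Proof.
move=> ts pos; have nz : word s *m sroot i != 0.
  apply/eqP => z; have := cform_word coxM s (sroot i) (sroot i).
  by rewrite z cform0r cform_sroot cox_form_diag // => /eqP; rewrite eq_sym oner_eq0.
rewrite cform_sumE lt_neqAle eq_sym sumr_ge0 ?andbT; last first.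
  by move=> k _; rewrite mulr_ge0 // ltW // sroot_plane_gt0.
apply: contra nz; rewrite psumr_eq0 => [/allP z|k _]; last first.
  by rewrite mulr_ge0 // ltW // sroot_plane_gt0.
apply/eqP/colP => k; have := z k (mem_index_enum k); rewrite /= mulf_eq0.
by rewrite (gt_eqF (sroot_plane_gt0 _ ts)) orbF [RHS]mxE => /eqP.
Qed.

Lemma root_plane_lt0 s i t : in_sector t -> nonneg (- (word s *m sroot i)) ->
  cform (word s *m sroot i) (plane t) < 0.
Proof.
move=> ts neg; have e : - (word s *m sroot i) = word (rcons s i) *m sroot i.
  by rewrite word_rcons -mulmxA refl_sroot // mulmxN.
by move: neg; rewrite -oppr_gt0 -cformNl e; exact: root_plane_gt0.
Qed.

Lemma root_plane_neq0 s i t : in_sector t ->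
  cform (word s *m sroot i) (plane t) != 0.
Proof.
move=> ts; have [pos|neg] := root_sign R coxM s i.
  by rewrite gt_eqF // root_plane_gt0.
by rewrite lt_eqF // root_plane_lt0.
Qed.

(** If a shortest word for the element ends in [i], the element sends [a_i] to a negative root.
    Fixing [plane t] would give that root the same positive pairing as [a_i]. *)
Lemma word_fix_plane s t : in_sector t -> word s *m plane t = plane t -> word s = 1%:M.
Proof.
move=> ts fixt; have [r rE rs] := wlen_word R M s.
case: (lastP r) rE rs => [|r0 i] rE rs; first by rewrite -rs.
have wlen_i : (wlen R M (rcons s i) <= wlen R M s)%N.
  rewrite -rE size_rcons leqW //; apply: wlen_le.
  by rewrite [in RHS]word_rcons -rs word_rcons -mulmxA reflK // mulmx1.
have neg : nonneg (word (rcons s i) *m sroot i).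
  apply: root_nonneg => //; rewrite [X in (_ <= X)%N](@wlen_eq _ _ _ _ s) //.
  by rewrite !word_rcons -mulmxA reflK // mulmx1.
rewrite word_rcons -mulmxA refl_sroot // mulmxN in neg.
have := root_plane_lt0 ts neg; rewrite -fixt cform_word //.
by rewrite ltNge (ltW (sroot_plane_gt0 i ts)).
Qed.

(** A translate of the sector by a multiple of [phi] is the image of the sector under a group
    element: a power of [c] for even multiples, combined with the factor [b] for odd ones. Odd
    multiples lead to the mirror image [pi - phi - t] of [t] within the sector. *)
Lemma root_plane_shift s i t j : in_sector t ->
  cform (word s *m sroot i) (plane (t + phi *+ j)) != 0.
Proof.
move=> ts; set x := t + phi *+ j.
have key r t' : in_sector t' -> word r *m plane x = plane t' ->
    cform (word s *m sroot i) (plane x) != 0.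
  move=> ts' e; rewrite -(cform_word coxM r) e mulmxA -word_cat.
  exact: root_plane_neq0.
have [jE | jE] : j = j./2.*2 \/ j = j./2.*2.+1.
  by have := odd_double_half j; case: odd => /esym; [right | left].
  have [r rE] := mxpow_word R M (b ++ w) j./2.
  apply: (key r t ts); rewrite -rE coxpow_plane /x {1}jE -mul2n mulrnA.
  by rewrite addrK.
have [r rE] := mxpow_word R M (b ++ w) j./2.+1.
apply: (key (rev b ++ r) (pi - phi - t)).
  by move/andP: ts => [t1 t2]; have p2 := phi_le; apply/andP; split; lra.
rewrite word_cat -mulmxA -rE coxpow_plane.
have -> : x - phi *+ 2 *+ j./2.+1 = pi - phi *+ 2 - (pi - phi - t).
  rewrite /x {1}jE -mul2n mulrSr mulrnA (mulrSr (phi *+ 2)).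
  by move: (phi *+ 2 *+ _) => y; rewrite mulr2n; ring.
by rewrite -word_b_planeR mulmxA word_rev // mul1mx.
Qed.

Lemma sroot_plane_zero i : cform (sroot i) (plane (pi + pi / 2 - phi)) = 0 \/
  cform (sroot i) (plane (pi + pi / 2)) = 0.
Proof.
have c32 : cos (pi + pi / 2) = 0 :> R by rewrite addrC cosDpi cos_pihalf oppr0.
have := mem_bw i; rewrite mem_cat => /orP[ib|iw]; [left|right].
  by rewrite sroot_plane_b // subrK c32 mulr0 oppr0.
by rewrite sroot_plane_w // c32 mulr0.
Qed.

(* The function [cform a_i (plane t)] vanishes nowhere inside the translates of
   the sector by multiples of [phi], so [pi] is a multiple of [phi]. *)
Lemma phi_divides_pi (i : 'I_n) : exists2 m, (0 < m)%N & phi *+ m = pi.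
Proof.
have p0 := pi_gt0 R; have p1 := phi_gt0; have p2 := phi_le.
pose P j := phi *+ j <= pi.
have P1 : P 1 by rewrite /P mulr1n; lra.
have [N nPN] : exists N, ~~ P N.
  exists (Num.Def.archi_bound (pi / phi)).
  rewrite /P -ltNge -mulr_natl -ltr_pdivrMr //.
  by apply: archi_boundP; rewrite divr_ge0 // ltW.
have [| m /andP[m1 _] /andP[Pm]] := last_true P1 nPN.
  case: N nPN => // /negP[]; rewrite /P mulr0n; exact: ltW.
rewrite {1}/P -ltNge mulrSr => m_lt; exists m => //.
apply: contra_eq (isT) => // mphi.
have r0 : 0 < pi - phi *+ m by rewrite subr_gt0 lt_neqAle mphi.
(* The remainder of [pi] modulo [phi] places [t] inside the sector, while [t + m phi] and
   [t + (m + 1) phi] are the two candidate zeros from [sroot_plane_zero]. *)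
pose t := pi / 2 - phi + (pi - phi *+ m).
have ts : in_sector t by apply/andP; rewrite /t; split; lra.
have := root_plane_shift [::] i m ts; have := root_plane_shift [::] i m.+1 ts.
rewrite !mul1mx mulrSr.
have -> : t + (phi *+ m + phi) = pi + pi / 2 by rewrite /t; ring.
have -> : t + phi *+ m = pi + pi / 2 - phi by rewrite /t; ring.
by have [->|->] := sroot_plane_zero i; rewrite ?eqxx.
Qed.

Definition mid_sector := pi / 2 - phi / 2.

Lemma mid_sectorP : in_sector mid_sector.
Proof. by have p1 := phi_gt0; apply/andP; rewrite /mid_sector; split; lra. Qed.

(** With [m phi = pi], the power [c^m] turns the parameter by a full period, so it fixes a point of
    the open chamber and is 1. Minimality gives [h <= m]. *)
Lemma cox_order (i : 'I_n) h : (0 < h)%N ->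
  (forall k, (0 < k < h)%N -> mxpow c k != 1%:M) -> (phi *+ 2) *+ h <= pi *+ 2.
Proof.
move=> h0 hmin; have [m m0 mphi] := phi_divides_pi i.
have cm : mxpow c m = 1%:M.
  have [r rE] := mxpow_word R M (b ++ w) m; rewrite rE.
  apply: (word_fix_plane mid_sectorP); rewrite -rE coxpow_plane mulrnAC mphi.
  have per x : sin (x - pi *+ 2) = sin x by rewrite -[in RHS](subrK (pi *+ 2) x) sinD2pi.
  by move: mid_sector => y; rewrite /plane addrAC !per.
rewrite mulrnAC lerMn2r /= -mphi ler_pMn2l // leqNgt; apply/negP => mh.
by have := hmin m; rewrite m0 mh cm eqxx => /(_ isT).
Qed.

(** A fixed vector satisfies [w u = b u]. The corrections on the two sides have disjoint supports,
    so both vanish, [u] is orthogonal to all simple roots, and positive definiteness applies. *)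
Lemma cox_fixed (u : 'cV[R]_n) : c *m u = u -> u = 0.
Proof.
move=> cu; have wu : word w *m u = word b *m u.
  by rewrite -{2}cu word_cat -mulmxA word_involutive ?uniq_b.
move: wu; rewrite !word_indep ?uniq_w ?uniq_b // => /addrI/oppr_inj e.
have coord s j : uniq s -> j \in s ->
    (\sum_(i <- s) (2 * cform (sroot i) u) *: sroot i) j 0 = 2 * cform (sroot j) u.
  move=> us sj; rewrite summxE (bigD1_seq j) //= !mxE !eqxx mulr1 big1 ?addr0 //.
  by move=> k kj; rewrite !mxE eq_sym (negPf kj) mulr0.
have coord0 s j : j \notin s ->
    (\sum_(i <- s) (2 * cform (sroot i) u) *: sroot i) j 0 = 0.
  move=> sj; rewrite summxE big_seq big1 // => k ks.
  by rewrite !mxE (_ : j == k = false) ?mulr0 //; apply: contraNF sj => /eqP->.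
have z j : cform (sroot j) u = 0.
  have := congr1 (fun v : 'cV_n => v j 0) e; have := mem_bw j.
  have : ~~ ((j \in b) && (j \in w)).
    apply/negP => /andP[jb jw]; move: uniq_bw; rewrite cat_uniq => /and3P[_ /hasPn/(_ _ jw)].
    by rewrite /= jb.
  rewrite mem_cat negb_and; case jb: (j \in b) => /=.
    by move=> jw _; rewrite coord0 // coord ?uniq_b //; lra.
  by move=> _ jw; rewrite coord ?uniq_w // coord0 ?jb //; lra.
apply/eqP; apply: contraT => /cform_pos; rewrite cform_sumE big1 ?ltxx // => k _.
by rewrite z mulr0.
Qed.

Lemma mxpowD (A : 'M[R]_n) j k : mxpow A (j + k) = mxpow A j *m mxpow A k.
Proof.
elim: j => [|j IH]; first by rewrite mul1mx.
by rewrite addSn /mxpow /= -/(mxpow A (j + k)) IH mulmxA.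
Qed.

Definition is_nonneg (v : 'cV[R]_n) := [forall k, 0 <= v k 0].

Lemma is_nonnegP v : reflect (nonneg v) (is_nonneg v).
Proof. exact: forallP. Qed.

Lemma root_pos_plane s i t : in_sector t ->
  is_nonneg (word s *m sroot i) = (0 < cform (word s *m sroot i) (plane t)).
Proof.
move=> ts; apply/is_nonnegP/idP => [|pos]; first exact: root_plane_gt0.
by case: (root_sign R coxM s i) => // /(root_plane_lt0 ts); rewrite ltNge ltW.
Qed.

Lemma root_neg_plane s i t : in_sector t ->
  ~~ is_nonneg (word s *m sroot i) = (cform (word s *m sroot i) (plane t) < 0).
Proof.
by move=> ts; rewrite (root_pos_plane _ _ ts) -leNgt le_eqVlt (negPf (root_plane_neq0 _ _ ts)).
Qed.

(** * One sign drop per orbit of the Coxeter element *)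

Variable h : nat.
Hypothesis h_gt0 : (0 < h)%N.
Hypothesis cox_h : mxpow c h = 1%:M.
Hypothesis cox_min : forall k, (0 < k < h)%N -> mxpow c k != 1%:M.

Definition sign_drop (v : 'cV[R]_n) k :=
  is_nonneg (mxpow c k *m v) && ~~ is_nonneg (mxpow c k.+1 *m v).

(** The sum over a full cycle is fixed by [c]. Its vanishing prevents a root from keeping one sign
    along its whole orbit. *)
Lemma cox_sum0 (v : 'cV[R]_n) : \sum_(k < h) mxpow c k *m v = 0.
Proof.
apply: cox_fixed; rewrite mulmx_sumr.
have -> : \sum_(k < h) c *m (mxpow c k *m v) = \sum_(k < h) mxpow c k.+1 *m v.
  by apply: eq_bigr => k _; rewrite mulmxA.
case: h h_gt0 cox_h => // h' _ ch; rewrite big_ord_recr [RHS]big_ord_recl addrC.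
by congr (_ + _); first exact: (congr1 (mulmx^~ v) ch).
Qed.

Lemma cox_word_root k s i :
  exists r, mxpow c k *m (word s *m sroot i) = word r *m sroot i.
Proof.
by have [t ->] := mxpow_word R M (b ++ w) k; exists (t ++ s); rewrite mulmxA word_cat.
Qed.

Lemma cox_sum_plane s i :
  \sum_(k < h) cform (mxpow c k *m (word s *m sroot i)) (plane mid_sector) = 0.
Proof.
under eq_bigr do rewrite cformC //.
by rewrite -cform_sumr cox_sum0 cform0r.
Qed.

Lemma cox_sign_pos s i : exists2 k, (k < h)%N & is_nonneg (mxpow c k *m (word s *m sroot i)).
Proof.
have [/existsP[k kP]|] := boolP [exists k : 'I_h, is_nonneg (mxpow c k *m (word s *m sroot i))].
  by exists k.
rewrite negb_exists => /forallP neg; exfalso.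
have lt k : 0 < - cform (mxpow c k *m (word s *m sroot i)) (plane mid_sector) \/ (h <= k)%N.
  have [hk|kh] := leqP h k; [by right | left].
  have := neg (Ordinal kh); have [r /= ->] := cox_word_root k s i.
  by rewrite (root_neg_plane _ _ mid_sectorP) oppr_gt0.
have := cox_sum_plane s i; rewrite (bigD1 (Ordinal h_gt0)) //= => /eqP.
apply/negP; rewrite -oppr_eq0 opprD -sumrN gt_eqF // ltr_pwDl //.
  by case: (lt 0%N) => //; rewrite leqNgt h_gt0.
by apply: sumr_ge0 => k _; case: (lt k) => [/ltW //|]; rewrite leqNgt ltn_ord.
Qed.

Lemma cox_sign_neg s i : exists2 k, (k < h)%N & ~~ is_nonneg (mxpow c k *m (word s *m sroot i)).
Proof.
have [k kh kP] := cox_sign_pos (rcons s i) i; exists k => //.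
move: kP; rewrite word_rcons -mulmxA refl_sroot // !mulmxN.
have [r ->] := cox_word_root k s i.
rewrite (root_neg_plane _ _ mid_sectorP) => /is_nonnegP.
exact: root_plane_lt0 mid_sectorP.
Qed.

Lemma mxpow_cox_mod k : mxpow c k = mxpow c (k %% h).
Proof.
rewrite {1}(divn_eq k h) mxpowD; suff -> : mxpow c (k %/ h * h) = 1%:M by rewrite mul1mx.
by elim: (k %/ h)%N => // q IH; rewrite mulSn mxpowD cox_h IH mul1mx.
Qed.

Lemma sign_drop_mod v k : sign_drop v k = sign_drop v (k %% h).
Proof.
rewrite /sign_drop (mxpow_cox_mod k) (mxpow_cox_mod k.+1).
by rewrite (mxpow_cox_mod (k %% h).+1) -(addn1 (k %% h)) modnDml addn1.
Qed.

Lemma sign_drop_exists s i : exists2 k, (k < h)%N & sign_drop (word s *m sroot i) k.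
Proof.
set v := word s *m sroot i.
have [k1 k1h pos] := cox_sign_pos s i; have [k2 k2h neg] := cox_sign_neg s i.
pose P k := is_nonneg (mxpow c k *m v).
(* Shifting by a full period puts the negative index after the positive one; the drop found between
   them is then reduced modulo [h]. *)
have nP : ~~ P (k2 + h)%N by rewrite /P mxpowD cox_h mulmx1.
have [|k _ Pk] := last_true (pos : P k1) nP; first by lia.
by exists (k %% h)%N; rewrite ?ltn_mod // -sign_drop_mod.
Qed.

(** The signs along the orbit are those of a sinusoid sampled with step [2 phi], and by [cox_order]
    the [h] steps cover at most one period. *)
Lemma sign_drop_uniq s i j k : (j < k < h)%N -> sign_drop (word s *m sroot i) j ->
  ~~ sign_drop (word s *m sroot i) k.
Proof.
move=> /andP[jk kh] /andP[pj nj]; apply/negP => /andP[pk nk].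
have order := cox_order i h_gt0 cox_min.
pose t0 := mid_sector + (phi *+ 2) *+ j.
(* The pairing of the root with [plane x], with [sin (x + phi)] expanded. *)
pose f x := cform (word s *m sroot i) (half_sum b + cos phi *: half_sum w) * sin x +
  cform (word s *m sroot i) (sin phi *: half_sum w) * cos x.
have fE x : f x = cform (word s *m sroot i) (plane x).
  by rewrite /f /plane !(cformDr, cformZr) sinD; ring.
have valE l : f (mid_sector + (phi *+ 2) *+ l) =
    cform (mxpow c l *m (word s *m sroot i)) (plane mid_sector).
  rewrite fE; have [r rE] := mxpow_word R M (b ++ w) l.
  by rewrite -[in LHS](cform_word coxM r) -rE coxpow_plane addrK.
have posE l : is_nonneg (mxpow c l *m (word s *m sroot i)) = (0 < f (mid_sector + (phi *+ 2) *+ l)).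
  rewrite valE; have [r ->] := cox_word_root l s i.
  by rewrite (root_pos_plane _ _ mid_sectorP).
have negE l : ~~ is_nonneg (mxpow c l *m (word s *m sroot i)) = (f (mid_sector + (phi *+ 2) *+ l) < 0).
  rewrite valE; have [r ->] := cox_word_root l s i.
  by rewrite (root_neg_plane _ _ mid_sectorP).
rewrite !posE in pj pk; rewrite !negE in nj nk.
apply: (@sinusoid_sign_changes _ _ _ t0 (phi *+ 2) ((phi *+ 2) *+ (k - j)) _ _ _ pj).
- by rewrite pmulrn_lgt0.
- by rewrite -{1}[phi *+ 2]mulr1n ler_wpMn2l ?mulrn_wge0 ?ltW // subn_gt0.
- by rewrite -mulrSr; apply: le_trans order; rewrite ler_wpMn2l ?mulrn_wge0 ?ltW //; lia.
- by move: nj; rewrite mulrSr addrA.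
- by move: pk; rewrite -{1}(subnKC (ltnW jk)) mulrnDr addrA.
- by move: nk; rewrite mulrSr -{1}(subnKC (ltnW jk)) mulrnDr !addrA.
Qed.

Lemma sum_sign_drop s i : (\sum_(k < h) sign_drop (word s *m sroot i) k = 1)%N.
Proof.
have [k kh dk] := sign_drop_exists s i; rewrite (bigD1 (Ordinal kh)) //= dk.
rewrite big1 // => j jk; apply/eqP; rewrite eqb0; move: jk; rewrite -val_eqE /= neq_ltn.
case/orP => [jk|kj]; last by apply: sign_drop_uniq dk; rewrite kj ltn_ord.
by apply/negP => /(sign_drop_uniq (k := k)); rewrite jk kh dk => /(_ isT).
Qed.

End CoxeterPlane.

(** * Counting *)

Section Counting.
Variables (R : realType) (n : nat) (M : 'M[nat]_n) (L : seq 'M[R]_n) (h : nat).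
Hypothesis coxM : coxeter_matrix M.
Hypothesis irrM : coxeter_irreducible M.
Hypothesis uniqL : uniq L.
Hypothesis memL : forall w, w \in L <-> in_W M w.
Hypothesis cox_h : is_coxeter_number R M h.
Local Notation word := (word_mx R M).
Local Notation sroot := (@sroot R n).
Local Notation cform := (@cform R n M).

(** Perron-Frobenius is applied to twice the identity minus twice [gram], a nonnegative matrix whose
    support is the Coxeter graph. Its eigenvalue lies in [[0, 2)] and is written [2 cos phi]. *)
Lemma coxeter_perron (i0 : 'I_n) : exists (p : 'I_n -> R) (phi : R),
  [/\ forall i, 0 < p i, 0 < phi, phi <= pi / 2 & forall i,
    cform (sroot i) (\sum_k p k *: sroot k) = (1 - cos phi) * p i].
Proof.
pose A : 'M[R]_n := \matrix_(i, j) if i == j then 0 else - (2 * cox_form R M i j).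
have symA i j : A i j = A j i by rewrite !mxE eq_sym cox_formC.
have A_ge0 i j : 0 <= A i j.
  by rewrite mxE; case: eqVneq => // /(cox_form_le0 R coxM); lra.
have conn i j : connect (fun a b => 0 < A a b) i j.
  apply: connect_sub (irrM i j) => a b ab; apply: connect1; rewrite mxE.
  case: eqVneq ab => [->|_ /(cox_form_le R)]; first by rewrite coxM.1.
  by lra.
have [p [mu [p0 pE]]] := perron_frobenius symA A_ge0 i0 conn.
have eig i : cform (sroot i) (\sum_k p k *: sroot k) = (1 - mu / 2) * p i.
  have -> : (1 - mu / 2) * p i = p i - mu * p i / 2 by field.
  rewrite -pE cform_sumr (bigD1 i) //= cformZr cform_sroot cox_form_diag // mulr1.
  rewrite [in RHS](bigD1 i) //= mxE eqxx mul0r add0r mulr_suml -sumrN.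
  congr (_ + _); apply: eq_bigr => j ji.
  by rewrite cformZr cform_sroot mxE eq_sym (negPf ji); field.
have mu0 : 0 <= mu.
  rewrite -(pmulr_lge0 _ (p0 i0)) -pE sumr_ge0 // => j _.
  by rewrite mulr_ge0 // ltW.
(* On the eigenvector the form equals [(1 - mu / 2)] times the sum of the [p k ^ 2], and it is
   positive. *)
have mu2 : mu < 2.
  pose x : 'cV[R]_n := \sum_k p k *: sroot k.
  have xE k : x k 0 = p k.
    rewrite summxE (bigD1 k) //= !mxE !eqxx mulr1 big1 ?addr0 // => j jk.
    by rewrite !mxE eq_sym (negPf jk) mulr0.
  have x0 : x != 0.
    by apply/eqP => /(congr1 (fun v : 'cV_n => v i0 0)) /eqP; rewrite xE mxE gt_eqF.
  have := cform_gt0 coxM irrM uniqL memL x0; rewrite cform_sumE.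
  under eq_bigr do rewrite eig xE mulrCA.
  rewrite -mulr_sumr pmulr_lgt0; first by lra.
  rewrite (bigD1 i0) //= ltr_pwDl ?mulr_gt0 // sumr_ge0 // => j _.
  by rewrite mulr_ge0 // ltW.
have pi0 := pi_gt0 R.
exists p, (acos (mu / 2)); split=> //.
- by apply: acos_gt0; apply/andP; split; lra.
- rewrite leNgt; apply/negP => gt.
  have le : acos (mu / 2) <= pi by apply: acos_lepi; apply/andP; split; lra.
  have : 0 < sin (acos (mu / 2) - pi / 2).
    by apply: sin_gt0_pi; apply/andP; split; lra.
  have cE : cos (acos (mu / 2)) = mu / 2 by rewrite acosK // in_itv /=; apply/andP; split; lra.
  by rewrite sinB cos_pihalf sin_pihalf cE mulr0 sub0r mulr1; lra.
by move=> i; rewrite eig acosK // in_itv /=; apply/andP; split; lra.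
Qed.

Lemma word_coord s j (v : 'cV[R]_n) : j \notin s -> (word s *m v) j 0 = v j 0.
Proof.
elim: s => [|i s IH]; first by rewrite mul1mx.
rewrite inE negb_or => /andP[/negPf ji js] /=.
rewrite -(IH js) -mulmxA refl_mulE; move: (word s *m v) => u.
by rewrite !mxE ji mulr0 subr0.
Qed.

Definition sent_neg s (v : 'cV[R]_n) := is_nonneg v && ~~ is_nonneg (word s *m v).

Lemma is_nonneg_sroot j : is_nonneg (sroot j).
Proof. by apply/is_nonnegP => k; rewrite mxE; case: (_ && _). Qed.

Lemma is_nonnegN r i : is_nonneg (- (word r *m sroot i)) = ~~ is_nonneg (word r *m sroot i).
Proof.
apply/is_nonnegP/idP => [neg|].
  by apply/negP => /is_nonnegP pos; exact: (root_nonneg_anti coxM pos neg).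
by case: (root_sign R coxM r i) => // /is_nonnegP ->.
Qed.

Lemma is_nonneg_refl r i j : word r *m sroot i != sroot j ->
  word r *m sroot i != - sroot j ->
  is_nonneg (simple_refl R M j *m (word r *m sroot i)) = is_nonneg (word r *m sroot i).
Proof.
move=> nj nNj; have [pos|neg] := boolP (is_nonneg (word r *m sroot i)).
  by apply/is_nonnegP/(refl_nonneg coxM); first exact/is_nonnegP.
apply/negbTE; rewrite mulmxA -[simple_refl _ _ _ *m _]/(word (j :: r)) -is_nonnegN.
have e : - (word r *m sroot i) = word (rcons r i) *m sroot i.
  by rewrite word_rcons -mulmxA refl_sroot // mulmxN.
rewrite /= -mulmxA -mulmxN e; apply/is_nonnegP/(refl_nonneg coxM).
  by apply/is_nonnegP; rewrite -e is_nonnegN.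
by rewrite -e eqr_oppLR.
Qed.

(* The coordinate on [a_j] is not changed by [word t], so a root that becomes
   negative at the letter [j] was positive from the start, and conversely a root
   made negative by [word t] cannot be [- a_j] when it meets [j]. *)
Lemma sent_neg_cons j t r i : j \notin t ->
  (sent_neg (j :: t) (word r *m sroot i) =
   sent_neg t (word r *m sroot i) + (word t *m (word r *m sroot i) == sroot j) :> nat)%N.
Proof.
move=> jt; rewrite /sent_neg /= -mulmxA.
have coordj : (word t *m (word r *m sroot i)) j 0 = (word r *m sroot i) j 0.
  exact: word_coord.
have [g gE] : exists g, word t *m (word r *m sroot i) = word g *m sroot i.
  by exists (t ++ r); rewrite mulmxA word_cat.
rewrite gE in coordj *.
have [gj|gj] := eqVneq (word g *m sroot i) (sroot j).
  have b0 : is_nonneg (word r *m sroot i).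
    apply: contraT; rewrite -is_nonnegN => /is_nonnegP/(_ j).
    by rewrite mxE -coordj gj mxE !eqxx oppr_ge0 ler10.
  rewrite b0 gj is_nonneg_sroot refl_sroot // -[sroot j]mul1mx.
  by rewrite (is_nonnegN [::]) mul1mx is_nonneg_sroot.
rewrite addn0; have [b0|//] := boolP (is_nonneg (word r *m sroot i)).
have gNj : word g *m sroot i != - sroot j.
  apply/eqP => e; have /is_nonnegP/(_ j) := b0.
  by rewrite -coordj e !mxE !eqxx oppr_ge0 ler10.
by rewrite is_nonneg_refl.
Qed.

Lemma sum_mull_nat s (F : 'M[R]_n -> nat) :
  (\sum_(w <- L) F (word s *m w) = \sum_(w <- L) F w)%N.
Proof. exact: (sum_mull coxM uniqL memL s F). Qed.

Lemma sum_mulr_nat s (F : 'M[R]_n -> nat) :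
  (\sum_(w <- L) F (w *m word s) = \sum_(w <- L) F w)%N.
Proof. exact: (sum_mulr coxM uniqL memL s F). Qed.

Definition hits i j := (\sum_(w <- L) (w *m sroot i == sroot j))%N.

(** For a tail [j :: t] of the word, the letter [j] makes the root negative when [word t] has
    carried [w a_i] to [a_j]. Left translation by [word t] turns the count of such [w] into
    [hits i j]. *)
Lemma sum_sent_neg s i : uniq s ->
  (\sum_(w <- L) sent_neg s (w *m sroot i) = \sum_(j <- s) hits i j)%N.
Proof.
elim: s => [_|j s IH /andP[js us]].
  by rewrite big_nil big1 // => w _; rewrite /sent_neg mul1mx andbN.
rewrite big_cons -IH // addnC.
rewrite {1}/hits -(sum_mull_nat s (fun w => w *m sroot i == sroot j)).
rewrite -[RHS]big_split /=; apply: eq_big_seq => w wL.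
have [r ->] := mem_word memL wL.
by rewrite sent_neg_cons // mulmxA.
Qed.

(** Double counting of the pairs [(k, w)] with a sign drop of [w a_i] at step [k]: each [w] has
    exactly one drop, and each of the [h] steps contributes the same count, by left translation by
    [c^k]. *)
Lemma hits_coxeter_number i : (h * \sum_j hits i j = size L)%N.
Proof.
have [h0 [ch cmin]] := cox_h.
have leaf S i1 := @leaf_exists R n M L coxM irrM uniqL memL S i1.
have [b [w [bw ib iw]]] := bipartite_word coxM leaf (enum_uniq 'I_n).
have pbw := cox_equiv_perm bw.
have ubw : uniq (b ++ w) by rewrite -(perm_uniq pbw) enum_uniq.
have mbw j : j \in b ++ w by rewrite -(perm_mem pbw) mem_enum.
have conj k := cox_equiv_mxpow1 R coxM k bw.
have ch' : mxpow (word (b ++ w)) h = 1%:M by apply/conj.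
have cmin' k : (0 < k < h)%N -> mxpow (word (b ++ w)) k != 1%:M.
  by move=> /cmin; apply: contra => /eqP/conj/eqP.
have [p [phi [p0 phi0 phi1 pE]]] := coxeter_perron i.
have pd u := @cform_gt0 R n M L coxM irrM uniqL memL u.
have one r := @sum_sign_drop R n M coxM pd b w ubw mbw ib iw p phi p0 phi0 phi1 pE h h0 ch' cmin' r i.
have drop k : (\sum_(v <- L) sign_drop M b w (v *m sroot i) k = \sum_j hits i j)%N.
  have -> : (\sum_j hits i j = \sum_(j <- b ++ w) hits i j)%N.
    by rewrite -big_enum; apply: perm_big.
  rewrite -sum_sent_neg //; have [r rE] := mxpow_word R M (b ++ w) k.
  rewrite -(sum_mull_nat r (fun v => sent_neg (b ++ w) (v *m sroot i))).
  by apply: eq_bigr => v _; rewrite /sign_drop /sent_neg -rE -!mulmxA.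
transitivity (\sum_(k < h) \sum_(v <- L) sign_drop M b w (v *m sroot i) k)%N.
  rewrite [RHS](eq_bigr (fun=> (\sum_j hits i j)%N)) => [|k _]; last exact: drop.
  by rewrite sum_nat_const card_ord.
rewrite exchange_big /= -sum1_size; apply: eq_big_seq => v vL.
by have [r ->] := mem_word memL vL; rewrite one.
Qed.

Definition root_sg (w : 'M[R]_n) i : R := (-1) ^+ ~~ is_nonneg (w *m sroot i).

Lemma root_sgNr r i : root_sg (word r *m simple_refl R M i) i = - root_sg (word r) i.
Proof.
rewrite /root_sg -mulmxA refl_sroot // mulmxN is_nonnegN negbK.
by case: is_nonneg; rewrite ?opprK.
Qed.

Lemma sum_root_sg i : \sum_(w <- L) root_sg w i = 0.
Proof.
have := sum_mulr coxM uniqL memL [:: i] (root_sg^~ i); rewrite word1.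
rewrite (eq_big_seq (fun w => - root_sg w i)) ?sumrN => [|w wL]; first by lra.
by have [r ->] := mem_word memL wL; rewrite root_sgNr.
Qed.

Lemma des_root_sg w : w \in L -> \sum_i root_sg w i = n%:R - 2 * (des w)%:R.
Proof.
move=> wL; have [r rE] := mem_word memL wL.
have -> : des w = (\sum_i ~~ is_nonneg (w *m sroot i))%N.
  rewrite /des -sum1dep_card big_mkcond; apply: eq_bigr => i _.
  rewrite rE -is_nonnegN.
  have -> : is_nonneg (- (word r *m sroot i)) = [forall k, word r k i <= 0].
    by apply: eq_forallb => k; rewrite mxE oppr_ge0 -colE mxE.
  by case: ifP.
rewrite natr_sum mulr_sumr -[n in n%:R]card_ord -sumr_const -sumrB.
by apply: eq_bigr => i _; rewrite /root_sg; case: is_nonneg => /=; ring.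
Qed.

(** The terms of [w] and [s_j w] cancel unless [w a_i] is [a_j] or [- a_j], when both are 1. *)
Lemma sum_root_sg_inv i j :
  \sum_(w <- L) root_sg w i * root_sg (invmx w) j = 2 * (hits i j)%:R.
Proof.
pose F w := root_sg w i * root_sg (invmx w) j.
have e1 := sum_mull coxM uniqL memL [:: j] F.
(* [w a_i = - a_j] means [(w s_i) a_i = a_j], so both exceptional cases occur equally often. *)
have e2 := sum_mulr_nat [:: i] (fun w => w *m sroot i == sroot j).
have e3 : \sum_(w <- L) (F w + F (word [:: j] *m w)) = \sum_(w <- L)
    (2 * (w *m sroot i == sroot j)%:R + 2 * (w *m word [:: i] *m sroot i == sroot j)%:R).
  apply: eq_big_seq => w wL; have [r ->] := mem_word memL wL.
  have F2 : F (word [:: j] *m word r) =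
      - (root_sg (simple_refl R M j *m word r) i * root_sg (invmx (word r)) j).
    rewrite /F -word_cat !word_inv // rev_cons word_rcons root_sgNr mulrN.
    by [].
  rewrite F2 /F word1 -(mulmxA (word r)) refl_sroot // mulmxN eqr_oppLR {F2 e1 e2}.
  have inv_root v : word r *m v = sroot j -> invmx (word r) *m sroot j = v.
    by move=> <-; rewrite mulmxA mulVmx ?word_unit // mul1mx.
  have sj : is_nonneg (- sroot j) = false.
    by rewrite -[sroot j]mul1mx (is_nonnegN [::]) mul1mx is_nonneg_sroot.
  have si : is_nonneg (- sroot i) = false.
    by rewrite -[sroot i]mul1mx (is_nonnegN [::]) mul1mx is_nonneg_sroot.
  have jNj : sroot j != - sroot j.
    by apply/eqP => e; move: (is_nonneg_sroot j); rewrite e sj.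
  have [rj|rj] := eqVneq (word r *m sroot i) (sroot j).
    rewrite rj (negPf jNj) /root_sg (inv_root _ rj) rj -mulmxA rj refl_sroot //.
    by rewrite sj !is_nonneg_sroot /=; ring.
  have [rNj|rNj] := eqVneq (word r *m sroot i) (- sroot j).
    have rj' : word r *m - sroot i = sroot j by rewrite mulmxN rNj opprK.
    rewrite /root_sg (inv_root _ rj') -mulmxA rNj mulmxN refl_sroot // opprK.
    by rewrite sj si is_nonneg_sroot /=; ring.
  by rewrite /root_sg -mulmxA is_nonneg_refl //= !mulr0 addr0 subrr.
move: e3; rewrite !big_split /= e1 -!mulr_sumr -!natr_sum e2 -/(hits i j) -/F.
by lra.
Qed.

End Counting.

(** * Mean and variance *)

Theorem theorem5p1 (R : realType) (n : nat) (M : 'M[nat]_n) (h : nat)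
  (L : seq 'M[R]_n) :
  coxeter_matrix M ->
  coxeter_irreducible M ->
  uniq L ->
  (forall w, w \in L <-> @in_W R n M w) ->
  @is_coxeter_number R n M h ->
  mean L (fun w => ((des w + des (invmx w))%:R : R)) = n%:R /\
  variance L (fun w => ((des w + des (invmx w))%:R : R)) =
    2 * variance L (fun w => ((des w)%:R : R)) + n%:R / h%:R.
Proof.
move=> coxM irrM uniqL memL cox_h; have [h0 _] := cox_h.
have hR : h%:R != 0 :> R by rewrite pnatr_eq0 -lt0n.
(* [E w = n - 2 des w] is centred, so the variances become averages of products of [E w] and
   [E (invmx w)]. *)
pose E (w : 'M[R]_n) := \sum_i root_sg w i.
have invL w : w \in L -> invmx w \in L.
  by move=> /(mem_word memL)[s ->]; rewrite word_inv // (word_mem memL).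
have desE w : w \in L -> (des w)%:R = n%:R / 2 - E w / 2 :> R.
  by move=> wL; rewrite /E (des_root_sg coxM memL wL); field.
have NR : (size L)%:R != 0 :> R.
  rewrite pnatr_eq0 -lt0n; have := word_mem memL [::].
  by case: (L).
have sumE : \sum_(w <- L) E w = 0.
  by rewrite exchange_big big1 // => i _; exact: (sum_root_sg coxM uniqL memL).
have sumE' : \sum_(w <- L) E (invmx w) = 0.
  by rewrite (sum_inv coxM uniqL memL E).
(* For each [i], the sum over [j] is twice the total of [hits i j], that is [2 (size L) / h]. *)
have sumEE : \sum_(w <- L) E w * E (invmx w) = 2 * n%:R * (size L)%:R / h%:R.
  under eq_bigr do rewrite /E mulr_suml.
  rewrite exchange_big /= (eq_bigr (fun=> 2 * (size L)%:R / h%:R)).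
    by rewrite sumr_const card_ord -mulr_natr; ring.
  move=> i _; under eq_bigr do rewrite mulr_sumr.
  rewrite exchange_big /=.
  under eq_bigr do rewrite (sum_root_sg_inv coxM uniqL memL).
  rewrite -mulr_sumr -natr_sum -(hits_coxeter_number coxM irrM uniqL memL cox_h i).
  by rewrite natrM; field.
have sum_const (x : R) : \sum_(w <- L) x = x * (size L)%:R.
  by rewrite big_const_seq count_predT iter_addr_0 mulr_natr.
have mean_des : mean L (fun w => (des w)%:R : R) = n%:R / 2.
  rewrite /mean (eq_big_seq _ desE) sumrB -!mulr_suml sumE mul0r subr0.
  by rewrite sum_const; field.
have mean2 : mean L (fun w => ((des w + des (invmx w))%:R : R)) = n%:R.
  rewrite /mean (eq_big_seq (fun w => n%:R - E w / 2 - E (invmx w) / 2)).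
    by rewrite !sumrB -!mulr_suml sumE sumE' sum_const; field.
  by move=> w wL; rewrite natrD !desE ?invL //; field.
split=> //; rewrite /variance mean2 mean_des {1 2}/mean.
(* Expansion of [((E w + E (invmx w)) / 2)^2]: each square averages to the variance of [des], and
   the cross term to [n / h]. *)
rewrite (eq_big_seq (fun w => E w ^+ 2 / 4 + E (invmx w) ^+ 2 / 4 + E w * E (invmx w) / 2)); last first.
  by move=> w wL; rewrite natrD !desE ?invL //; field.
rewrite [in RHS](eq_big_seq (fun w => E w ^+ 2 / 4)); last first.
  by move=> w wL; rewrite desE //; field.
rewrite !big_split /= (sum_inv coxM uniqL memL (fun w => E w ^+ 2 / 4)).
by rewrite -!mulr_suml sumEE; field; rewrite hR NR.
Qed.
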